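(* A complete $ANR$-space $M$ is a Krasinkiewicz space if and only if $M$ has an open cover consisting of sets each of which (as a subspace) is a Krasinkiewicz space.
   Context: A complete $ANR$-space is a metrizable absolute neighborhood retract admitting a compatible complete metric. For a compact metrizable $X$, a map $g\colon X\to M$ is Krasinkiewicz if every subcontinuum of $X$ is either contained in a fiber of $g$ or contains a component of some fiber of $g$; a metrizable space $M$ is a Krasinkiewicz space if for every compact metrizable $X$ the Krasinkiewicz maps are dense in $C(X,M)$ with the uniform topology. *)

(* Defs.v *)
From Stdlib Require Import Reals List ProofIrrelevance.
Open Scope R_scope.

Definition is_metric {T : Type} (d : T -> T -> R) : Prop :=
  (forall x y, 0 <= d x y) /\
  (forall x y, d x y = 0 <-> x = y) /\
  (forall x y, d x y = d y x) /\
  (forall x y z, d x z <= d x y + d y z).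

Record MetricSpace := MkMetricSpace {
  carrier :> Type;
  dist : carrier -> carrier -> R;
  dist_is_metric : is_metric dist }.

Definition open_wrt {T : Type} (d : T -> T -> R) (U : T -> Prop) : Prop :=
  forall x, U x -> exists eps, 0 < eps /\ forall y, d x y < eps -> U y.

Definition is_open {M : MetricSpace} (U : M -> Prop) : Prop := open_wrt (dist M) U.

Definition is_closed {M : MetricSpace} (A : M -> Prop) : Prop :=
  is_open (fun x => ~ A x).

Definition continuous {M N : MetricSpace} (f : M -> N) : Prop :=
  forall x eps, 0 < eps -> exists del, 0 < del /\
    forall y, dist M x y < del -> dist N (f x) (f y) < eps.

Definition complete_wrt {T : Type} (d : T -> T -> R) : Prop :=
  forall u : nat -> T,
    (forall eps, 0 < eps -> exists N, forall m n, (N <= m)%nat -> (N <= n)%nat ->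
        d (u m) (u n) < eps) ->
    exists l, forall eps, 0 < eps -> exists N, forall n, (N <= n)%nat -> d (u n) l < eps.

Definition completely_metrizable (M : MetricSpace) : Prop :=
  exists d' : M -> M -> R, is_metric d' /\
    (forall U : M -> Prop, open_wrt (dist M) U <-> open_wrt d' U) /\
    complete_wrt d'.

Definition sub_dist (M : MetricSpace) (U : M -> Prop) (x y : {z : M | U z}) : R :=
  dist M (proj1_sig x) (proj1_sig y).

Lemma sub_dist_is_metric (M : MetricSpace) (U : M -> Prop) : is_metric (sub_dist M U).
Proof.
  destruct (dist_is_metric M) as [H0 [H1 [H2 H3]]].
  unfold sub_dist; split; [|split; [|split]].
  - intros; apply H0.
  - intros [x hx] [y hy]; simpl; split.
    + intro h; apply H1 in h; subst y.
      rewrite (proof_irrelevance _ hx hy); reflexivity.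
    + intro h; injection h; intro; subst; apply H1; reflexivity.
  - intros; apply H2.
  - intros; apply H3.
Qed.

Definition Subspace (M : MetricSpace) (U : M -> Prop) : MetricSpace :=
  MkMetricSpace {z : M | U z} (sub_dist M U) (sub_dist_is_metric M U).

Definition compact_set {X : MetricSpace} (A : X -> Prop) : Prop :=
  forall F : (X -> Prop) -> Prop,
    (forall U, F U -> is_open U) ->
    (forall x, A x -> exists U, F U /\ U x) ->
    exists l : list (X -> Prop),
      (forall U, In U l -> F U) /\ (forall x, A x -> exists U, In U l /\ U x).

Definition compact_space (X : MetricSpace) : Prop := compact_set (fun _ : X => True).

Definition connected_set {X : MetricSpace} (A : X -> Prop) : Prop :=
  forall U V : X -> Prop, is_open U -> is_open V ->
    (forall x, A x -> U x \/ V x) ->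
    (forall x, A x -> U x -> V x -> False) ->
    (forall x, A x -> U x) \/ (forall x, A x -> V x).

Definition subset {X : Type} (A B : X -> Prop) : Prop := forall x, A x -> B x.

Definition subcontinuum {X : MetricSpace} (K : X -> Prop) : Prop :=
  (exists x, K x) /\ compact_set K /\ connected_set K.

Definition component_of {X : MetricSpace} (C F : X -> Prop) : Prop :=
  (exists x, C x) /\ subset C F /\ connected_set C /\
  (forall D, connected_set D -> subset C D -> subset D F -> subset D C).

Definition fiber {X M : Type} (g : X -> M) (y : M) : X -> Prop := fun x => g x = y.

Definition krasinkiewicz_map {X M : MetricSpace} (g : X -> M) : Prop :=
  forall K : X -> Prop, subcontinuum K ->
    (exists y, subset K (fiber g y)) \/
    (exists y C, component_of C (fiber g y) /\ subset C K).

Definition krasinkiewicz_space (M : MetricSpace) : Prop :=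
  forall X : MetricSpace, compact_space X ->
    forall (f : X -> M) (eps : R), continuous f -> 0 < eps ->
      exists g : X -> M, continuous g /\ krasinkiewicz_map g /\
        forall x, dist M (f x) (g x) < eps.

Definition closed_embedding {M Y : MetricSpace} (e : M -> Y) : Prop :=
  continuous e /\
  (forall x x', e x = e x' -> x = x') /\
  (forall x eps, 0 < eps -> exists del, 0 < del /\
     forall x', dist Y (e x) (e x') < del -> dist M x x' < eps) /\
  is_closed (fun y => exists x, e x = y).

Definition ANR (M : MetricSpace) : Prop :=
  forall (Y : MetricSpace) (e : M -> Y), closed_embedding e ->
    exists V : Y -> Prop, is_open V /\ (forall x, V (e x)) /\
      exists r : Subspace Y V -> M, continuous r /\
        forall x (h : V (e x)), r (exist _ (e x) h) = x.

Definition complete_ANR (M : MetricSpace) : Prop :=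
  ANR M /\ completely_metrizable M.

(* Main.v *)
(* From local to global: cover X by finitely many closed sets A_i = f^-1(F_i), with F_i inside
   a Krasinkiewicz open set U_i. Since M is an ANR, a Krasinkiewicz map A_i -> U_i close to f
   extends to a map X -> M close to f. Being Krasinkiewicz on A_i is a countable intersection
   of conditions that hold in a neighborhood of each Krasinkiewicz map, so a Baire argument
   gives g near f whose restriction to every A_i is Krasinkiewicz. Finally, if g is not constant
   on a continuum K, boundary bumping gives a subcontinuum of K on which g is not constant but
   has image so small that all fibers of g over it lie in a single A_i.
   For the extension, M with a complete metric is embedded isometrically (at scales below 1) as
   a closed subset of a space of real functions, into which maps extend by McShane's formula. *)
From mathcomp Require filter.
From Stdlib Require Import Reals List Lra Lia Classical ClassicalEpsilon FunctionalExtensionality PropExtensionality ProofIrrelevance.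
Require Import Defs.

(** Repairing a map on one [A_i] moves it on the others, and being Krasinkiewicz need not survive a
    small move. Hence the splitting into conditions with eps = 1/(n+1), each of which leaves a
    positive tolerance for later corrections. Both the stability of these conditions and their
    sufficiency rest on one fact: every open set containing a component of a fiber contains a
    relatively clopen part of the fiber around that component, and by compactness the two open sets
    that split this fiber also split all nearby ones. A connected set with small enough image that
    meets the first open set then cannot leave it. Completeness serves twice: for the limit in the
    Baire argument, and for making the image of M in the function space closed, so that the ANR
    property yields a retraction. The notions involved are topological, which allows the given
    metric to be exchanged for a complete one. *)

(** * Elementary metric estimates *)

Lemma dist_nonneg (M : MetricSpace) (x y : M) : 0 <= dist M x y.
Proof. apply (dist_is_metric M). Qed.

Lemma dist_refl (M : MetricSpace) (x : M) : dist M x x = 0.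
Proof. apply (dist_is_metric M); reflexivity. Qed.

Lemma dist_eq0 (M : MetricSpace) (x y : M) : dist M x y = 0 -> x = y.
Proof. apply (dist_is_metric M). Qed.

Lemma dist_sym (M : MetricSpace) (x y : M) : dist M x y = dist M y x.
Proof. apply (dist_is_metric M). Qed.

Lemma dist_tri (M : MetricSpace) (x y z : M) : dist M x z <= dist M x y + dist M y z.
Proof. apply (dist_is_metric M). Qed.

Lemma dist_pos (M : MetricSpace) (x y : M) : x <> y -> 0 < dist M x y.
Proof.
  intro ne. destruct (dist_nonneg M x y) as [h|h]; [exact h|].
  exfalso; apply ne, dist_eq0; auto.
Qed.

Lemma dist_lipschitz (M : MetricSpace) (x y m : M) :
  Rabs (dist M x m - dist M y m) <= dist M x y.
Proof.
  apply Rabs_le.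
  pose proof (dist_tri M x y m); pose proof (dist_tri M y x m).
  rewrite (dist_sym M y x) in *; lra.
Qed.

Lemma inv_INR_lt (eps : R) : 0 < eps -> exists N : nat, / (INR N + 1) < eps.
Proof.
  intro h. destruct (archimed_cor1 eps h) as [N [h1 h2]].
  exists N. apply Rlt_trans with (/ INR N); [|exact h1].
  apply Rinv_lt_contravar; [|lra].
  apply Rmult_lt_0_compat; apply lt_INR in h2; simpl in h2; lra.
Qed.

Lemma inv_INR_pos (n : nat) : 0 < / (INR n + 1).
Proof. apply Rinv_0_lt_compat; pose proof (pos_INR n); lra. Qed.

Lemma inv_INR_antitone (m n : nat) : (m <= n)%nat -> / (INR n + 1) <= / (INR m + 1).
Proof.
  intro h. apply Rinv_le_contravar; [pose proof (pos_INR m); lra|].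
  apply le_INR in h; lra.
Qed.

(** * Open, closed and compact sets *)

Lemma open_ball (M : MetricSpace) (x : M) (r : R) : is_open (fun y => dist M x y < r).
Proof.
  intros y hy. exists (r - dist M x y); split; [lra|].
  intros z hz. pose proof (dist_tri M x y z); lra.
Qed.

Lemma open_far (M : MetricSpace) (x : M) (r : R) : is_open (fun y => r < dist M x y).
Proof.
  intros y hy. exists (dist M x y - r); split; [lra|].
  intros z hz. pose proof (dist_tri M x z y). rewrite (dist_sym M z y) in *; lra.
Qed.

Lemma open_preimage (X M : MetricSpace) (g : X -> M) (U : M -> Prop) :
  continuous g -> is_open U -> is_open (fun x => U (g x)).
Proof.
  intros hg hU x hx. destruct (hU _ hx) as [e [he h]].
  destruct (hg x e he) as [r [hr hr']].
  exists r; split; auto.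
Qed.

Lemma open_and (X : MetricSpace) (U V : X -> Prop) :
  is_open U -> is_open V -> is_open (fun x => U x /\ V x).
Proof.
  intros hU hV x [h1 h2].
  destruct (hU x h1) as [a [ha ha']], (hV x h2) as [b [hb hb']].
  exists (Rmin a b); split; [apply Rmin_pos; auto|].
  intros y hy; split; [apply ha'|apply hb'];
    pose proof (Rmin_l a b); pose proof (Rmin_r a b); lra.
Qed.

Lemma open_or (X : MetricSpace) (U V : X -> Prop) :
  is_open U -> is_open V -> is_open (fun x => U x \/ V x).
Proof.
  intros hU hV x [h|h].
  - destruct (hU x h) as [a [ha ha']]. exists a; split; auto.
  - destruct (hV x h) as [a [ha ha']]. exists a; split; auto.
Qed.

Lemma open_union (X : MetricSpace) (F : (X -> Prop) -> Prop) :
  (forall U, F U -> is_open U) -> is_open (fun x => exists U, F U /\ U x).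
Proof.
  intros hF x [U [hU hx]]. destruct (hF U hU x hx) as [a [ha h]].
  exists a; split; [auto|]. intros y hy; exists U; auto.
Qed.

Lemma open_nbhd (X : MetricSpace) (A : X -> Prop) (r : R) :
  is_open (fun x => exists a, A a /\ dist X a x < r).
Proof.
  intros x [a [ha hx]]. exists (r - dist X a x); split; [lra|].
  intros y hy; exists a; split; [exact ha|].
  pose proof (dist_tri X a x y); lra.
Qed.

Lemma closed_ball_preimage (X M : MetricSpace) (g : X -> M) (p : M) (r : R) :
  continuous g -> is_closed (fun x => dist M p (g x) <= r).
Proof.
  intros hg x hx. apply Rnot_le_lt in hx.
  destruct (open_preimage X M g _ hg (open_far M p r) x hx) as [e [he h]].
  exists e; split; [exact he|]. intros y hy; apply Rlt_not_le, h, hy.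
Qed.

Lemma closed_fiber (X M : MetricSpace) (g : X -> M) (p : M) :
  continuous g -> is_closed (fiber g p).
Proof.
  intros hg x hx. unfold fiber in hx.
  assert (h0 : 0 < dist M p (g x)) by (apply dist_pos; auto).
  destruct (open_preimage X M g _ hg (open_far M p 0) x h0) as [e [he h]].
  exists e; split; [exact he|]. intros y hy e1; red in e1.
  specialize (h y hy); simpl in h. rewrite e1, dist_refl in h; lra.
Qed.

Lemma closed_in_compact (X : MetricSpace) (A B : X -> Prop) :
  compact_set A -> is_closed B -> compact_set (fun x => A x /\ B x).
Proof.
  intros hA hB F hF hcov.
  destruct (hA (fun U => F U \/ U = (fun x => ~ B x))) as [l [hl1 hl2]].
  - intros U [h| ->]; [auto|exact hB].
  - intros x hx. destruct (classic (B x)) as [hb|hb].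
    + destruct (hcov x (conj hx hb)) as [U [h1 h2]]. exists U; auto.
    + exists (fun x => ~ B x); auto.
  - assert (hs : forall l : list (X -> Prop),
      (forall U, In U l -> F U \/ U = (fun x => ~ B x)) ->
      exists l', (forall U, In U l' -> F U) /\
        forall U, In U l -> In U l' \/ U = (fun x => ~ B x)).
    { clear. induction l as [|U l IH]; intros h.
      - exists nil; split; [intros ? []|intros ? []].
      - destruct IH as [l' [h1 h2]]; [intros; apply h; right; auto|].
        destruct (h U (or_introl eq_refl)) as [hU|hU].
        + exists (U :: l'); split.
          * intros V [<-|hV]; auto.
          * intros V [<-|hV]; [left; left; auto|].
            destruct (h2 V hV); [left; right|right]; auto.
        + exists l'; split; [auto|]. intros V [<-|hV]; auto. }
    destruct (hs l hl1) as [l' [h1 h2]]. exists l'; split; [exact h1|].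
    intros x [ha hb]. destruct (hl2 x ha) as [U [hU hx]].
    destruct (h2 U hU) as [h| ->]; [exists U; auto|contradiction].
Qed.

Lemma compact_set_ext (X : MetricSpace) (A B : X -> Prop) :
  (forall x, A x <-> B x) -> compact_set A -> compact_set B.
Proof.
  intros e hA F hF hcov. destruct (hA F hF) as [l [h1 h2]].
  - intros x hx; apply hcov, e, hx.
  - exists l; split; [exact h1|]. intros x hx; apply h2, e, hx.
Qed.

Lemma closed_compact (X : MetricSpace) (B : X -> Prop) :
  compact_space X -> is_closed B -> compact_set B.
Proof.
  intros hX hB.
  apply compact_set_ext with (fun x => True /\ B x); [tauto|].
  apply closed_in_compact; auto.
Qed.

Lemma compact_set_closed (X : MetricSpace) (A : X -> Prop) : compact_set A -> is_closed A.
Proof.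
  intros hA x hx.
  destruct (hA (fun U => exists n : nat, U = fun y => / (INR n + 1) < dist X x y))
    as [l [hl1 hl2]].
  - intros U [n ->]; apply open_far.
  - intros y hy. assert (h : 0 < dist X x y) by (apply dist_pos; intro; subst; auto).
    destruct (inv_INR_lt _ h) as [N hN]. eexists; split; [exists N; reflexivity|exact hN].
  - assert (hs : exists N : nat, forall U, In U l -> forall y, U y -> / (INR N + 1) < dist X x y).
    { clear hl2. induction l as [|U l IH].
      - exists 0%nat; intros ? [].
      - destruct IH as [N hN]; [intros; apply hl1; right; auto|].
        destruct (hl1 U (or_introl eq_refl)) as [n hn].
        exists (max n N). intros V [<-|hV] y hy.
        + rewrite hn in hy. apply Rle_lt_trans with (/ (INR n + 1)); [|exact hy].
          apply inv_INR_antitone; lia.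
        + apply Rle_lt_trans with (/ (INR N + 1)); [|exact (hN V hV y hy)].
          apply inv_INR_antitone; lia. }
    destruct hs as [N hN]. exists (/ (INR N + 1)); split; [apply inv_INR_pos|].
    intros y hy hy'. destruct (hl2 y hy') as [U [hU hUy]].
    specialize (hN U hU y hUy); lra.
Qed.

(** A Lebesgue-number principle: [P] is inherited by smaller constants, so the least of finitely
    many local constants works everywhere. *)
Lemma compact_uniform (X : MetricSpace) (P : X -> R -> Prop) :
  compact_space X ->
  (forall x r s, 0 < s <= r -> P x r -> P x s) ->
  (forall x, exists r e, 0 < r /\ 0 < e /\ forall y, dist X x y < r -> P y e) ->
  exists e, 0 < e /\ forall x, P x e.
Proof.
  intros hX hmon hloc.
  destruct (hX (fun U => is_open U /\ exists e, 0 < e /\ forall y, U y -> P y e))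
    as [l [hl1 hl2]].
  - intros U [h _]; exact h.
  - intros x _. destruct (hloc x) as [r [e [hr [he h]]]].
    exists (fun y => dist X x y < r); split; [split; [apply open_ball|eauto]|].
    rewrite dist_refl; exact hr.
  - assert (hs : exists e, 0 < e /\ forall U, In U l -> forall y, U y -> P y e).
    { clear hl2. induction l as [|U l IH].
      - exists 1; split; [lra|intros ? []].
      - destruct IH as [e [he h]]; [intros; apply hl1; right; auto|].
        destruct (hl1 U (or_introl eq_refl)) as [_ [e' [he' h']]].
        exists (Rmin e e'). assert (h0 : 0 < Rmin e e') by (apply Rmin_pos; auto).
        split; [exact h0|]. intros V [<-|hV] y hy.
        + apply hmon with e'; [split; [exact h0|apply Rmin_r]|auto].
        + apply hmon with e; [split; [exact h0|apply Rmin_l]|eauto]. }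
    destruct hs as [e [he h]]. exists e; split; [exact he|].
    intro x. destruct (hl2 x I) as [U [hU hx]]. eauto.
Qed.

Lemma uniform_continuity (X M : MetricSpace) (g : X -> M) :
  compact_space X -> continuous g -> forall eps, 0 < eps ->
  exists r, 0 < r /\ forall x y, dist X x y < r -> dist M (g x) (g y) < eps.
Proof.
  intros hX hg eps heps.
  apply (compact_uniform X (fun x r => forall y, dist X x y < r -> dist M (g x) (g y) < eps));
    [exact hX| |].
  - intros x r s hs h y hy; apply h; lra.
  - intro x. destruct (hg x (eps / 2)) as [r [hr h]]; [lra|].
    exists (r / 2), (r / 2). split; [lra|split; [lra|]].
    intros y hy z hz.
    pose proof (dist_tri X x y z). assert (h1 := h z ltac:(lra)). assert (h2 := h y ltac:(lra)).
    pose proof (dist_tri M (g y) (g x) (g z)). rewrite (dist_sym M (g y) (g x)) in *; lra.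
Qed.

(** Off [G] the distance from [p] to [g x] is positive and locally bounded below; compactness makes
    the bound uniform. *)
Lemma fiber_tube (X M : MetricSpace) (g : X -> M) (p : M) (G : X -> Prop) :
  compact_space X -> continuous g -> is_open G -> subset (fiber g p) G ->
  exists r, 0 < r /\ forall x, dist M p (g x) < r -> G x.
Proof.
  intros hX hg hG hsub.
  apply (compact_uniform X (fun x r => dist M p (g x) < r -> G x)); [exact hX| |].
  - intros x r s hs h hx; apply h; lra.
  - intro x. destruct (classic (G x)) as [hx|hx].
    + destruct (hG x hx) as [r [hr h]]. exists r, 1. split; [auto|split; [lra|auto]].
    + assert (hpos : 0 < dist M p (g x)).
      { apply dist_pos; intro e; apply hx, hsub; red; auto. }
      destruct (open_preimage X M g _ hg (open_far M p (dist M p (g x) / 2)) x) as [r [hr h]];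
        [lra|].
      exists r, (dist M p (g x) / 2). split; [auto|split; [lra|]].
      intros y hy hy'. specialize (h y hy); simpl in h; lra.
Qed.

(** * Ultrafilter limits in compact spaces *)

(** Ultrafilters containing all tails replace repeated passage to subsequences: one choice makes
    points and continua converge simultaneously. *)
Definition ultrafilter (U : (nat -> Prop) -> Prop) : Prop :=
  (forall A B : nat -> Prop, U A -> (forall n, A n -> B n) -> U B) /\
  (forall A B : nat -> Prop, U A -> U B -> U (fun n => A n /\ B n)) /\
  (forall A : nat -> Prop, U A \/ U (fun n => ~ A n)) /\
  (forall N : nat, U (fun n => (N <= n)%nat)) /\
  (forall A : nat -> Prop, U A -> exists n, A n).

Lemma ultrafilter_exists : exists U, ultrafilter U.
Proof.
  pose (F := fun A : nat -> Prop => exists N, forall n, (N <= n)%nat -> A n).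
  assert (pF : @filter.ProperFilter nat F).
  { split.
    - intros [N h]. exact (h N (le_n N)).
    - split.
      + exists 0%nat; intros; exact I.
      + intros A B [N h] [N' h']; exists (max N N'); intros n hn; split;
          [apply h|apply h']; lia.
      + intros A B hAB [N h]; exists N; intros n hn; apply hAB, h, hn. }
  destruct (filter.ultraFilterLemma pF) as [U [hU hsub]].
  pose proof (@filter.ultra_proper _ _ hU) as [hne [_ hI hS]].
  exists U. split; [|split; [|split; [|split]]].
  - intros A B hA hAB; exact (hS A B hAB hA).
  - intros A B hA hB; exact (hI A B hA hB).
  - intro A; exact (filter.in_ultra_setVsetC A hU).
  - intro N; apply hsub; exists N; auto.
  - intros A hA. apply NNPP; intro hn. apply hne.
    apply (hS A); [|exact hA]. intros n hn'; apply hn; exists n; exact hn'.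
Qed.

Lemma ultrafilter_or (U : (nat -> Prop) -> Prop) (A B : nat -> Prop) :
  ultrafilter U -> U (fun n => A n \/ B n) -> U A \/ U B.
Proof.
  intros [hS [hI [hC _]]] h. destruct (hC A) as [hA|hA]; [left; exact hA|right].
  apply hS with (1 := hI _ _ hA h). intros n [h1 [h2|h2]]; [contradiction|exact h2].
Qed.

Definition ulim (U : (nat -> Prop) -> Prop) {X : MetricSpace} (u : nat -> X) (x : X) : Prop :=
  forall r, 0 < r -> U (fun n => dist X x (u n) < r).

(** If no point were a limit, each would have an open neighborhood avoided by almost all [u n];
    finitely many of these cover [X], and some [u n] would lie in none of them. *)
Lemma ulim_exists (U : (nat -> Prop) -> Prop) (X : MetricSpace) (u : nat -> X) :
  ultrafilter U -> compact_space X -> exists x, ulim U u x.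
Proof.
  intros hU hX. apply NNPP; intro hn.
  destruct (hX (fun V => is_open V /\ U (fun n => ~ V (u n)))) as [l [h1 h2]].
  - intros V [h _]; exact h.
  - intros x _. apply NNPP; intro hx. apply hn; exists x. intros r hr.
    destruct hU as [_ [_ [hC _]]].
    destruct (hC (fun n => dist X x (u n) < r)) as [h|h]; [exact h|].
    exfalso; apply hx; exists (fun y => dist X x y < r); split; [split|].
    + apply open_ball.
    + exact h.
    + rewrite dist_refl; exact hr.
  - destruct hU as [hS [hI [_ [hN hex]]]].
    assert (h : U (fun n => forall V, In V l -> ~ V (u n))).
    { clear h2. induction l as [|V l IH].
      - apply hS with (1 := hN 0%nat); intros n _ V [].
      - apply hS with (1 := hI _ _ (proj2 (h1 V (or_introl eq_refl)))
                               (IH (fun W hW => h1 W (or_intror hW)))).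
        intros n [ha hb] W [<-|hW]; auto. }
    destruct (hex _ h) as [n hn']. destruct (h2 (u n) I) as [V [hV hV']].
    exact (hn' V hV hV').
Qed.

(** * Separations, components and boundary bumping *)

Lemma open_ext (X : MetricSpace) (A B : X -> Prop) :
  (forall x, A x <-> B x) -> is_open A -> is_open B.
Proof.
  intros e hA x hx. destruct (hA x (proj2 (e x) hx)) as [r [hr h]].
  exists r; split; [exact hr|]. intros y hy; apply e, h, hy.
Qed.

(** [connected_set] asks for disjointness only on the set itself, while the clopen and limit
    arguments need it in all of [X]. Radii around points of [Q] are halved: if two half-balls met,
    the center with the smaller radius would lie in both [U] and [V]. *)
Lemma disjoint_open_refinement (X : MetricSpace) (Q U V : X -> Prop) :
  is_open U -> is_open V -> (forall x, Q x -> U x -> V x -> False) ->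
  exists U' V' : X -> Prop, is_open U' /\ is_open V' /\
    (forall x, U' x -> V' x -> False) /\
    (forall x, Q x -> U x -> U' x) /\ (forall x, Q x -> V x -> V' x) /\ subset U' U.
Proof.
  intros hU hV hd.
  pose (half := fun (A : X -> Prop) (z : X) => exists a r, Q a /\ 0 < r /\
         (forall y, dist X a y < r -> A y) /\ dist X a z < r / 2).
  assert (ho : forall A, is_open (half A)).
  { intros A z [a [r [ha [hr [hb hz]]]]].
    exists (r / 2 - dist X a z); split; [lra|]. intros y hy.
    exists a, r; repeat split; auto. pose proof (dist_tri X a z y); lra. }
  assert (hin : forall A, is_open A -> forall x, Q x -> A x -> half A x).
  { intros A hA x hq hx. destruct (hA x hx) as [r [hr h]].
    exists x, r; repeat split; auto. rewrite dist_refl; lra. }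
  exists (half U), (half V). repeat split; auto.
  - intros z [a [r [ha [hr [hb hz]]]]] [a' [r' [ha' [hr' [hb' hz']]]]].
    pose proof (dist_tri X a z a') as h. rewrite (dist_sym X z a') in h.
    destruct (Rle_lt_dec r' r) as [hle|hlt].
    + apply (hd a' ha'); [apply hb; lra|apply hb'; rewrite dist_refl; lra].
    + apply (hd a ha); [apply hb; rewrite dist_refl; lra|].
      apply hb'; rewrite dist_sym; lra.
  - intros z [a [r [ha [hr [hb hz]]]]]. apply hb; lra.
Qed.

(** The two pieces of [F] are relatively clopen, but [W] and [W'] are open and disjoint in the whole
    space, so that they also control sets near [F]. *)
Definition separates {X : MetricSpace} (F W W' : X -> Prop) : Prop :=
  is_open W /\ is_open W' /\ (forall x, W x -> W' x -> False) /\
  (forall x, F x -> W x \/ W' x).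

Lemma connected_in_side (X : MetricSpace) (D F W W' : X -> Prop) (x : X) :
  connected_set D -> separates F W W' -> (forall z, D z -> W z \/ W' z) ->
  D x -> W x -> subset D W.
Proof.
  intros hD [hW [hW' [hd _]]] hsub hx hWx.
  destruct (hD W W' hW hW' hsub) as [h|h].
  - intros z _; apply hd.
  - exact h.
  - exfalso; exact (hd x hWx (h x hx)).
Qed.

(** Finitely many of the sets [W'] cover [E]; their union, paired with the intersection of the
    corresponding [W], is again a separation. *)
Lemma separates_compact (X : MetricSpace) (F E : X -> Prop) (x : X) :
  compact_set E ->
  (forall z, E z -> exists W W', separates F W W' /\ W x /\ W' z) ->
  exists W W', separates F W W' /\ W x /\ subset E W'.
Proof.
  intros hE h.
  destruct (hE (fun W' => exists W, separates F W W' /\ W x)) as [l [hl1 hl2]].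
  - intros W' [W [hs _]]; apply hs.
  - intros z hz. destruct (h z hz) as [W [W' [h1 [h2 h3]]]]. exists W'; eauto.
  - assert (hs : exists W W', separates F W W' /\ W x /\
                   forall V, In V l -> subset V W').
    { clear hl2 h. induction l as [|V l IH].
      - exists (fun _ => True), (fun _ => False).
        assert (ho : forall P : Prop, is_open (fun _ : X => P)).
        { intros P y hy; exists 1; split; [lra|auto]. }
        split; [split; [apply ho|split; [apply ho|split; auto]]|split; [exact I|intros ? []]].
      - destruct IH as [W [W' [[h1 [h2 [h3 h4]]] [h5 h6]]]];
          [intros; apply hl1; right; auto|].
        destruct (hl1 V (or_introl eq_refl)) as [Z [[k1 [k2 [k3 k4]]] k5]].
        exists (fun y => W y /\ Z y), (fun y => W' y \/ V y). repeat split; auto.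
        + apply open_and; auto.
        + apply open_or; auto.
        + intros y [a b] [c|c]; eauto.
        + intros y hy. destruct (h4 y hy), (k4 y hy); auto.
        + intros T [<-|hT] y hy; [right; exact hy|left; exact (h6 T hT y hy)]. }
    destruct hs as [W [W' [h1 [h2 h3]]]]. exists W, W'; split; [auto|split; [auto|]].
    intros z hz. destruct (hl2 z hz) as [V [hV hVz]]. exact (h3 V hV z hVz).
Qed.

(* The witness is the quasi-component; in a compact set it is connected. *)
Lemma component_exists (X : MetricSpace) (F : X -> Prop) (x : X) :
  compact_set F -> F x ->
  exists C : X -> Prop, compact_set C /\ connected_set C /\ C x /\ subset C F /\
    (forall D, connected_set D -> D x -> subset D F -> subset D C) /\
    (forall O, is_open O -> subset C O ->
       exists W W', separates F W W' /\ W x /\ subset W O).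
Proof.
  intros hF hx.
  pose (S := fun z => exists W', (exists W, separates F W W' /\ W x) /\ W' z).
  assert (hS : is_open S).
  { apply open_union. intros W' [W [h _]]; apply h. }
  pose (C := fun z => F z /\ ~ S z).
  assert (hCx : C x).
  { split; [exact hx|]. intros [W' [[W [[_ [_ [hd _]]] hW]] h]]; eauto. }
  assert (hcompl : forall z, F z -> ~ C z -> exists W W', separates F W W' /\ W x /\ W' z).
  { intros z hz hn. destruct (classic (S z)) as [[W' [[W [h1 h2]] h3]]|h].
    - exists W, W'; auto.
    - exfalso; apply hn; split; auto. }
  assert (hout : forall O, is_open O -> subset C O ->
            exists W W', separates F W W' /\ W x /\ forall z, F z -> ~ O z -> W' z).
  { intros O hO hsub.
    destruct (separates_compact X F (fun z => F z /\ ~ O z) x) as [W [W' [h1 [h2 h3]]]].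
    - apply closed_in_compact; [exact hF|].
      apply open_ext with O; [|exact hO]. intro z; split; [tauto|apply NNPP].
    - intros z [hz hn]. apply hcompl; auto.
    - exists W, W'; split; [auto|split; [auto|]]. intros z a b; apply h3; split; auto. }
  exists C. split; [|split; [|split; [|split; [|split]]]].
  - apply closed_in_compact; [exact hF|].
    apply open_ext with S; [|exact hS]. intro z; split; [tauto|apply NNPP].
  - assert (hside : forall U V : X -> Prop, is_open U -> is_open V ->
              (forall z, C z -> U z \/ V z) -> (forall z, C z -> U z -> V z -> False) ->
              U x -> forall z, C z -> U z).
    { intros U V hU hV hUV hd hUx.
      destruct (disjoint_open_refinement X C U V hU hV hd)
        as [U' [V' [oU [oV [d' [sU [sV _]]]]]]].
      destruct (hout (fun z => U' z \/ V' z)) as [W [W' [[h1 [h2 [h3 h4]]] [h5 h6]]]].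
      - apply open_or; auto.
      - intros z hz; destruct (hUV z hz); auto.
      - intros z hz. destruct (hUV z hz) as [h|h]; [exact h|exfalso].
        (* A point of [C] in [V] would be separated from [x] by the intersection of [W] and [U']:
           inside [W] the set [F] lies in [U'] or [V'], so this piece is still clopen in [F]. *)
        apply (proj2 hz). exists (fun y => W' y \/ V' y). split; [|right; auto].
        exists (fun y => W y /\ U' y). split; [|split; [auto|apply sU; auto]].
        split; [apply open_and; auto|split; [apply open_or; auto|split]].
        + intros y [a b] [c|c]; eauto.
        + intros y hy. destruct (h4 y hy) as [a|a]; [|auto].
          destruct (classic (U' y)); [auto|]. destruct (classic (V' y)); [auto|].
          right; left; apply h6; tauto. }
    intros U V hU hV hUV hd. destruct (hUV x hCx) as [h|h].
    + left; apply (hside U V); auto.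
    + right; apply (hside V U); auto.
      * intros z hz; destruct (hUV z hz); auto.
      * intros z hz a b; exact (hd z hz b a).
  - exact hCx.
  - intros z [h _]; exact h.
  - intros D hD hDx hDF z hz. split; [auto|].
    intros [W' [[W [hs hW]] h]].
    assert (h1 := connected_in_side X D F W W' x hD hs
                    (fun y hy => proj2 (proj2 (proj2 hs)) y (hDF y hy)) hDx hW z hz).
    exact (proj1 (proj2 (proj2 hs)) z h1 h).
  - intros O hO hsub. destruct (hout O hO hsub) as [W [W' [[h1 [h2 [h3 h4]]] [h5 h6]]]].
    exists (fun z => W z /\ O z), W'. split; [|split; [auto|intros z [_ h]; exact h]].
    split; [apply open_and; auto|split; [auto|split]].
    + intros z [a _]; eauto.
    + intros z hz. destruct (h4 z hz) as [a|a]; [|auto].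
      destruct (classic (O z)); [auto|right; auto].
Qed.

Lemma fiber_component (X M : MetricSpace) (g : X -> M) (x : X) :
  compact_space X -> continuous g ->
  exists C, component_of C (fiber g (g x)) /\ C x /\
    (forall D, connected_set D -> D x -> subset D (fiber g (g x)) -> subset D C).
Proof.
  intros hX hg.
  destruct (component_exists X (fiber g (g x)) x) as [C [h1 [h2 [h3 [h4 [h5 _]]]]]].
  - apply closed_compact; [exact hX|apply closed_fiber, hg].
  - reflexivity.
  - exists C; split; [|auto].
    split; [eauto|split; [exact h4|split; [exact h2|]]].
    intros D hD hCD hDF. apply h5; auto.
Qed.

(** [L] is the component of [x] in the part of [K] mapped into the closed ball of radius [r]. If [g]
    were constant on [L], there would be a relatively clopen neighborhood of [x] in that part,
    mapped into the open ball; it would be clopen in all of [K] although it misses [x1]. *)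
Lemma boundary_bumping (X M : MetricSpace) (g : X -> M) (K : X -> Prop) (x x1 : X) (r : R) :
  continuous g -> subcontinuum K -> K x -> K x1 -> 0 < r <= dist M (g x) (g x1) ->
  exists L, subcontinuum L /\ L x /\ subset L K /\
    (forall z, L z -> dist M (g x) (g z) <= r) /\ exists z, L z /\ g z <> g x.
Proof.
  intros hg [_ [hK1 hK2]] hx hx1 hr.
  pose (F := fun z => K z /\ dist M (g x) (g z) <= r).
  destruct (component_exists X F x) as [L [h1 [h2 [h3 [h4 [_ h6]]]]]].
  - apply closed_in_compact; [exact hK1|apply closed_ball_preimage, hg].
  - split; [exact hx|rewrite dist_refl; lra].
  - exists L. split; [split; [eauto|auto]|].
    split; [exact h3|split; [intros z hz; apply h4, hz|split; [intros z hz; apply h4, hz|]]].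
    apply NNPP; intro hn.
    destruct (h6 (fun z => dist M (g x) (g z) < r)) as [W [W' [[w1 [w2 [w3 w4]]] [w5 w6]]]].
    + apply (open_preimage X M g (fun y => dist M (g x) y < r)); [exact hg|apply open_ball].
    + intros z hz. destruct (classic (g z = g x)) as [->|ne].
      * rewrite dist_refl; lra.
      * exfalso; apply hn; eauto.
    + destruct (hK2 W (fun z => W' z \/ r < dist M (g x) (g z))) as [h|h].
      * exact w1.
      * apply open_or; [exact w2|]. apply (open_preimage X M g (fun y => r < dist M (g x) y));
          [exact hg|apply open_far].
      * intros z hz. destruct (Rle_lt_dec (dist M (g x) (g z)) r) as [hle|hlt]; [|auto].
        destruct (w4 z (conj hz hle)); auto.
      * intros z _ a [b|b]; [eauto|]. specialize (w6 z a); simpl in w6; lra.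
      * specialize (w6 x1 (h x1 hx1)); simpl in w6; lra.
      * destruct (h x hx) as [b|b]; [eauto|]. rewrite dist_refl in b; lra.
Qed.

(* Quantitative form of the Krasinkiewicz property: unlike the property itself,
   it survives small perturbations of a Krasinkiewicz map. *)
Definition eps_krasinkiewicz {X M : MetricSpace} (eps : R) (h : X -> M) : Prop :=
  forall L : X -> Prop, subcontinuum L ->
    (exists a b, L a /\ L b /\ eps <= dist M (h a) (h b)) ->
    exists x, L x /\ forall D, connected_set D -> D x -> subset D (fiber h (h x)) ->
      forall w, D w -> exists l, L l /\ dist X l w < eps.

(** * The approximate conditions: sufficiency and stability *)

(** The hypothesis supplies one good point [x] of [L], whereas all points of [L'] have to be good. A
    clopen part [W] of the fiber around the component of [x] stays near [L], so [L'] is taken around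
    [x] with image so small that connected parts of fibers through its points are trapped in [W]. *)
Lemma eps_krasinkiewicz_shrink (X M : MetricSpace) (g : X -> M) (L : X -> Prop) (eps : R) :
  compact_space X -> continuous g -> 0 < eps ->
  (forall e, 0 < e -> exists e', 0 < e' <= e /\ eps_krasinkiewicz e' g) ->
  subcontinuum L -> (exists a b, L a /\ L b /\ g a <> g b) ->
  exists L', subcontinuum L' /\ (exists a b, L' a /\ L' b /\ g a <> g b) /\ subset L' L /\
    forall x, L' x -> forall D, connected_set D -> D x -> subset D (fiber g (g x)) ->
      forall w, D w -> exists l, L l /\ dist X l w < eps.
Proof.
  intros hX hg heps hP hL [a [b [ha [hb hab]]]].
  apply dist_pos in hab.
  destruct (hP (Rmin eps (dist M (g a) (g b)))) as [e [he hPe]]; [apply Rmin_pos; auto|].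
  pose proof (Rmin_l eps (dist M (g a) (g b))). pose proof (Rmin_r eps (dist M (g a) (g b))).
  destruct (hPe L hL) as [x [hx hD]].
  { exists a, b; repeat split; auto; lra. }
  destruct (component_exists X (fiber g (g x)) x) as [C [h1 [h2 [h3 [h4 [_ h6]]]]]].
  { apply closed_compact; [exact hX|apply closed_fiber, hg]. }
  { reflexivity. }
  destruct (h6 (fun w => exists l, L l /\ dist X l w < e)) as [W [W' [hs [hW hO]]]].
  { apply open_nbhd. }
  { intros w hw. exact (hD C h2 h3 h4 w hw). }
  assert (hs' := hs). destruct hs' as [w1 [w2 [w3 w4]]].
  destruct (fiber_tube X M g (g x) (fun z => W z \/ W' z) hX hg) as [r [hr htube]].
  { apply open_or; auto. }
  { exact w4. }
  assert (hx1 : exists x1, L x1 /\ 0 < dist M (g x) (g x1)).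
  { destruct (classic (g a = g x)) as [e1|e1].
    - exists b; split; [exact hb|]. rewrite <- e1; exact hab.
    - exists a; split; [exact ha|]. apply dist_pos; auto. }
  destruct hx1 as [x1 [hx1 hne]].
  (* [r / 2] leaves the strict inequality that the tube requires; the second bound keeps [x1]
     outside the open ball, as boundary bumping demands. *)
  pose proof (Rmin_l (r / 2) (dist M (g x) (g x1))).
  pose proof (Rmin_r (r / 2) (dist M (g x) (g x1))).
  destruct (boundary_bumping X M g L x x1 (Rmin (r / 2) (dist M (g x) (g x1))))
    as [L' [k1 [k2 [k3 [k4 [z [k5 k6]]]]]]]; auto.
  { split; [apply Rmin_pos; lra|assumption]. }
  assert (hin : forall D y, connected_set D -> D y -> W y ->
            (forall w, D w -> dist M (g x) (g w) < r) -> subset D W).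
  { intros D y hD1 hDy hWy hDr.
    apply (connected_in_side X D (fiber g (g x)) W W' y); auto. }
  assert (hL'W : subset L' W).
  { apply (hin L' x); auto; [apply k1|]. intros w hw; specialize (k4 w hw); lra. }
  exists L'. split; [exact k1|split; [exists z, x; auto|split; [exact k3|]]].
  intros x' hx' D hD1 hDx' hDf w hw.
  destruct (hO w) as [l [hl hlw]].
  - apply (hin D x'); auto. intros v hv. rewrite (hDf v hv). specialize (k4 x' hx'); lra.
  - exists l; split; [exact hl|lra].
Qed.

(** Repeated shrinking with bounds 1/(n+1) gives nested continua. The fiber component of a point
    common to all of them is within 1/(n+1) of the n-th one for every n, hence inside the closed set
    [K]. *)
Lemma krasinkiewicz_of_eps (X M : MetricSpace) (g : X -> M) :
  compact_space X -> continuous g ->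
  (forall e, 0 < e -> exists e', 0 < e' <= e /\ eps_krasinkiewicz e' g) ->
  krasinkiewicz_map g.
Proof.
  intros hX hg hP K hK.
  destruct (classic (exists a b, K a /\ K b /\ g a <> g b)) as [hne|hconst].
  2:{ left. destruct hK as [[x hx] _]. exists (g x). intros z hz.
      apply NNPP; intro h; apply hconst; exists z, x; auto. }
  right.
  pose (good := fun L : X -> Prop => subcontinuum L /\ exists a b, L a /\ L b /\ g a <> g b).
  pose (small := fun (n : nat) (L L' : X -> Prop) => subset L' L /\
    forall x, L' x -> forall D, connected_set D -> D x -> subset D (fiber g (g x)) ->
      forall w, D w -> exists l, L l /\ dist X l w < / (INR n + 1)).
  assert (step : forall (n : nat) (L : sig good),
            {L' : sig good | small n (proj1_sig L) (proj1_sig L')}).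
  { intros n [L [hL1 hL2]]. apply constructive_indefinite_description.
    destruct (eps_krasinkiewicz_shrink X M g L _ hX hg (inv_INR_pos n) hP hL1 hL2)
      as [L' [h1 [h2 h3]]].
    exists (exist _ L' (conj h1 h2)); exact h3. }
  pose (Ks := fix Ks (n : nat) : sig good :=
    match n with O => exist _ K (conj hK hne) | S n => proj1_sig (step n (Ks n)) end).
  assert (hstep : forall n, small n (proj1_sig (Ks n)) (proj1_sig (Ks (S n)))).
  { intro n; simpl; destruct (step n (Ks n)) as [L' h]; exact h. }
  assert (hmono : forall n m, (n <= m)%nat -> subset (proj1_sig (Ks m)) (proj1_sig (Ks n))).
  { intros n m h; induction h as [|m h IH]; [intros z hz; exact hz|].
    intros z hz; apply IH, (proj1 (hstep m)), hz. }
  assert (hpt : forall n, exists x, proj1_sig (Ks n) x).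
  { intro n; destruct (proj2_sig (Ks n)) as [[h _] _]; exact h. }
  pose (u := fun n => proj1_sig (constructive_indefinite_description _ (hpt n))).
  assert (hu : forall n, proj1_sig (Ks n) (u n)).
  { intro n; unfold u; destruct (constructive_indefinite_description _ (hpt n)); auto. }
  destruct ultrafilter_exists as [U hU].
  destruct (ulim_exists U X u hU hX) as [x hx].
  assert (hin : forall n, proj1_sig (Ks n) x).
  { intro n. apply NNPP; intro hn.
    destruct (proj2_sig (Ks n)) as [[_ [hc _]] _].
    destruct (compact_set_closed X _ hc x hn) as [r [hr hball]].
    destruct hU as [_ [hI [_ [hN hex]]]].
    destruct (hex _ (hI _ _ (hx r hr) (hN n))) as [m [h1 h2]].
    apply (hball _ h1), (hmono n m h2), hu. }
  destruct (fiber_component X M g x hX hg) as [C [hC [hCx _]]].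
  exists (g x), C; split; [exact hC|].
  intros w hw. apply NNPP; intro hn.
  destruct (compact_set_closed X _ (proj1 (proj2 hK)) w hn) as [r [hr hball]].
  destruct (inv_INR_lt r hr) as [N hN].
  destruct hC as [_ [hCf [hCc _]]].
  destruct (proj2 (hstep N) x (hin (S N)) C hCc hCx hCf w hw) as [l [hl hlw]].
  apply (hball l); [rewrite dist_sym; lra|].
  exact (hmono 0%nat N ltac:(lia) l hl).
Qed.

(** Otherwise maps [h k] converging uniformly to [g] violate the condition on continua [L k]. The
    limit of the [L k] is a continuum on which [g] is not constant, so it contains a fiber component
    [C] of [g]. Connected parts of fibers of [h k] through points of [L k] near a point of [C] are
    trapped near the limit continuum, hence near [L k], against the choice of [L k]. *)
Lemma krasinkiewicz_stable (X M : MetricSpace) (g : X -> M) (eps : R) :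
  compact_space X -> continuous g -> krasinkiewicz_map g -> 0 < eps ->
  exists tau, 0 < tau /\ forall h : X -> M,
    (forall x, dist M (g x) (h x) < tau) -> eps_krasinkiewicz eps h.
Proof.
  intros hX hg hK heps. apply NNPP; intro hneg.
  assert (hbad : forall k : nat, exists t : (X -> M) * (X -> Prop) * (X * X),
    let '(h, L, (a, b)) := t in
    (forall x, dist M (g x) (h x) < / (INR k + 1)) /\ connected_set L /\
    L a /\ L b /\ eps <= dist M (h a) (h b) /\
    forall x, L x -> exists D w, connected_set D /\ D x /\ subset D (fiber h (h x)) /\ D w /\
      forall l, L l -> eps <= dist X l w).
  { intro k. apply NNPP; intro hn. apply hneg. exists (/ (INR k + 1)).
    split; [apply inv_INR_pos|]. intros h hh L hL [a [b [ha [hb hab]]]].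
    apply NNPP; intro hn'. apply hn. exists (h, L, (a, b)).
    split; [exact hh|split; [apply hL|repeat split; auto]].
    intros x hx. apply NNPP; intro hD. apply hn'. exists x; split; [exact hx|].
    intros D hD1 hD2 hD3 w hw. apply NNPP; intro hl. apply hD.
    exists D, w; repeat split; auto. intros l hl'.
    apply Rnot_lt_le; intro hlt; apply hl; eauto. }
  pose (t := fun k => proj1_sig (constructive_indefinite_description _ (hbad k))).
  pose (h := fun k => fst (fst (t k))). pose (L := fun k => snd (fst (t k))).
  pose (a := fun k => fst (snd (t k))). pose (b := fun k => snd (snd (t k))).
  assert (ht : forall k,
    (forall x, dist M (g x) (h k x) < / (INR k + 1)) /\ connected_set (L k) /\
    L k (a k) /\ L k (b k) /\ eps <= dist M (h k (a k)) (h k (b k)) /\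
    forall x, L k x -> exists D w, connected_set D /\ D x /\
      subset D (fiber (h k) (h k x)) /\ D w /\ forall l, L k l -> eps <= dist X l w).
  { intro k. unfold h, L, a, b, t.
    destruct (constructive_indefinite_description _ (hbad k)) as [[[h' L'] [a' b']] hp].
    exact hp. }
  clearbody h L a b. clear t hbad hneg.
  destruct ultrafilter_exists as [U hU].
  assert (hU' := hU). destruct hU' as [hS [hI [hC [hN hex]]]].
  (* [Lim] is the limit of the continua [L k] along the ultrafilter. *)
  pose (Lim := fun z => forall r, 0 < r -> U (fun k => exists y, L k y /\ dist X z y < r)).
  assert (hlim : forall (u : nat -> X) z, ulim U u z -> U (fun k => L k (u k)) -> Lim z).
  { intros u z hu hLu r hr. apply hS with (1 := hI _ _ (hu r hr) hLu).
    intros k [h1 h2]; eauto. }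
  assert (hclosed : is_closed Lim).
  { intros z hz.
    assert (hz' : exists r, 0 < r /\ U (fun k => ~ exists y, L k y /\ dist X z y < r)).
    { apply NNPP; intro hn; apply hz; intros r hr.
      destruct (hC (fun k => exists y, L k y /\ dist X z y < r)) as [h1|h1]; [exact h1|].
      exfalso; apply hn; eauto. }
    destruct hz' as [r [hr hUr]]. exists (r / 2); split; [lra|].
    intros y hy hLy. assert (hp := hI _ _ hUr (hLy (r / 2) ltac:(lra))).
    destruct (hex _ hp) as [k [h1 [v [h2 h3]]]]. apply h1; exists v; split; [exact h2|].
    pose proof (dist_tri X z y v); lra. }
  (* Almost all [L k] are covered by [A'] and [B'], since a limit of escaping points would lie in
     [Lim] but outside both. Each of these lies on one side, and the ultrafilter selects one side
     for almost all [k], leaving no point of [Lim] on the other. *)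
  assert (hconn : connected_set Lim).
  { intros A B hA hB hAB hd.
    destruct (disjoint_open_refinement X Lim A B hA hB hd)
      as [A' [B' [oA [oB [d' [sA [sB _]]]]]]].
    assert (hcov : U (fun k => forall y, L k y -> A' y \/ B' y)).
    { destruct (hC (fun k => forall y, L k y -> A' y \/ B' y)) as [h1|h1]; [exact h1|].
      exfalso.
      assert (hy : forall k, exists y, ~ (forall y, L k y -> A' y \/ B' y) ->
                L k y /\ ~ (A' y \/ B' y)).
      { intro k. destruct (classic (forall y, L k y -> A' y \/ B' y)) as [h2|h2].
        - exists (a k); intro; contradiction.
        - apply not_all_ex_not in h2. destruct h2 as [y hy]. exists y; intros _; tauto. }
      pose (u := fun k => proj1_sig (constructive_indefinite_description _ (hy k))).
      assert (hu : forall k, ~ (forall y, L k y -> A' y \/ B' y) ->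
                L k (u k) /\ ~ (A' (u k) \/ B' (u k))).
      { intro k; unfold u; destruct (constructive_indefinite_description _ (hy k)); auto. }
      destruct (ulim_exists U X u hU hX) as [z hz].
      assert (hzL : Lim z).
      { apply (hlim u z hz). apply hS with (1 := h1). intros k hk; apply hu, hk. }
      assert (hzO : A' z \/ B' z) by (destruct (hAB z hzL); auto).
      destruct (open_or X A' B' oA oB z hzO) as [r [hr hball]].
      destruct (hex _ (hI _ _ h1 (hz r hr))) as [k [h2 h3]].
      exact (proj2 (hu k h2) (hball _ h3)). }
    assert (hside : U (fun k => (forall y, L k y -> A' y) \/ (forall y, L k y -> B' y))).
    { apply hS with (1 := hcov). intros k hk.
      destruct (ht k) as [_ [hLk _]]. apply (hLk A' B'); eauto. }
    assert (hstay : forall P Q : X -> Prop, is_open Q -> (forall z, P z -> Q z -> False) ->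
              U (fun k => forall y, L k y -> P y) -> forall z, Lim z -> ~ Q z).
    { intros P Q oQ hPQ hUP z hz hQ. destruct (oQ z hQ) as [r [hr hball]].
      destruct (hex _ (hI _ _ hUP (hz r hr))) as [k [h1 [y [h2 h3]]]].
      exact (hPQ y (h1 y h2) (hball y h3)). }
    destruct (ultrafilter_or U _ _ hU hside) as [h1|h1].
    - left; intros z hz. destruct (hAB z hz) as [h2|h2]; [exact h2|].
      exfalso; apply (hstay A' B' oB d' h1 z hz); auto.
    - right; intros z hz. destruct (hAB z hz) as [h2|h2]; [|exact h2].
      exfalso; apply (hstay B' A' oA (fun v p q => d' v q p) h1 z hz); auto. }
  destruct (ulim_exists U X a hU hX) as [a0 ha0].
  destruct (ulim_exists U X b hU hX) as [b0 hb0].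
  assert (hLa : Lim a0).
  { apply (hlim a a0 ha0). apply hS with (1 := hN 0%nat); intros k _; apply ht. }
  assert (hLb : Lim b0).
  { apply (hlim b b0 hb0). apply hS with (1 := hN 0%nat); intros k _; apply ht. }
  assert (hab : g a0 <> g b0).
  { intro e. destruct (hg a0 (eps / 4) ltac:(lra)) as [r1 [hr1 hg1]].
    destruct (hg b0 (eps / 4) ltac:(lra)) as [r2 [hr2 hg2]].
    destruct (inv_INR_lt (eps / 4) ltac:(lra)) as [N hNe].
    destruct (hex _ (hI _ _ (hN N) (hI _ _ (ha0 r1 hr1) (hb0 r2 hr2)))) as [k [h1 [h2 h3]]].
    destruct (ht k) as [hh [_ [_ [_ [hek _]]]]].
    pose proof (inv_INR_antitone N k h1). specialize (hg1 _ h2). specialize (hg2 _ h3).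
    pose proof (hh (a k)) as ea. pose proof (hh (b k)) as eb.
    pose proof (dist_tri M (h k (a k)) (g (a k)) (h k (b k))).
    pose proof (dist_tri M (g (a k)) (g a0) (h k (b k))).
    pose proof (dist_tri M (g a0) (g (b k)) (h k (b k))).
    rewrite (dist_sym M (h k (a k)) (g (a k))), (dist_sym M (g (a k)) (g a0)) in *.
    rewrite e in *. lra. }
  assert (hsub : subcontinuum Lim).
  { split; [eauto|split; [apply closed_compact; auto|exact hconn]]. }
  destruct (hK Lim hsub) as [[y hy]|[y [C [[[x hx] [hCf [hCc hCmax]]] hCL]]]].
  { apply hab. rewrite (hy a0 hLa), (hy b0 hLb); reflexivity. }
  assert (hxy : g x = y) by exact (hCf x hx). subst y.
  destruct (component_exists X (fiber g (g x)) x) as [Q [q1 [q2 [q3 [q4 [q5 q6]]]]]].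
  { apply closed_compact; [exact hX|apply closed_fiber, hg]. }
  { reflexivity. }
  assert (hQC : subset Q C).
  { apply hCmax; auto. }
  destruct (q6 (fun w => exists l, Lim l /\ dist X l w < eps / 2)) as [W [W' [hs [hW hO]]]].
  { apply open_nbhd. }
  { intros w hw. exists w; split; [auto|rewrite dist_refl; lra]. }
  assert (hs' := hs). destruct hs' as [w1 [w2 [w3 w4]]].
  destruct (fiber_tube X M g (g x) (fun z => W z \/ W' z) hX hg) as [r [hr htube]].
  { apply open_or; auto. }
  { exact w4. }
  (* One third each for the distances from [g x] to [g z], from [g z] to [h k z], and from [h k z],
     which equals [h k v], to [g v]. *)
  destruct (hg x (r / 3) ltac:(lra)) as [r1 [hr1 hg1]].
  destruct (w1 x hW) as [r2 [hr2 hW2]].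
  destruct (inv_INR_lt (r / 3) ltac:(lra)) as [N hNr].
  assert (hfar : U (fun k => exists w, W w /\ forall l, L k l -> eps <= dist X l w)).
  { pose proof (Rmin_l r1 r2). pose proof (Rmin_r r1 r2).
    apply hS with (1 := hI _ _ (hN N) (hCL x hx (Rmin r1 r2) ltac:(apply Rmin_pos; auto))).
    intros k [hk [z [hz hxz]]]. destruct (ht k) as [hh [_ [_ [_ [_ hD]]]]].
    destruct (hD z hz) as [D [w [d1 [d2 [d3 [d4 d5]]]]]].
    exists w; split; [|exact d5].
    pose proof (inv_INR_antitone N k hk) as hNk.
    apply (connected_in_side X D (fiber g (g x)) W W' z); auto.
    - intros v hv. apply htube.
      pose proof (hg1 z ltac:(lra)). pose proof (hh z). pose proof (hh v) as hhv.
      rewrite (d3 v hv) in hhv.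
      pose proof (dist_tri M (g x) (g z) (g v)).
      pose proof (dist_tri M (g z) (h k z) (g v)).
      rewrite (dist_sym M (h k z) (g v)) in *; lra.
    - apply hW2; lra. }
  (* A far point is paired with a point of [Lim] within [eps / 2] of it; [(x, x)] is a dummy for
     indices without a far point. *)
  assert (hw : forall k, exists p : X * X,
            (exists w, W w /\ forall l, L k l -> eps <= dist X l w) ->
            Lim (snd p) /\ dist X (snd p) (fst p) < eps / 2 /\
            forall l, L k l -> eps <= dist X l (fst p)).
  { intro k.
    destruct (classic (exists w, W w /\ forall l, L k l -> eps <= dist X l w)) as [h1|h1].
    - destruct h1 as [w [hw1 hw2]]. destruct (hO w hw1) as [l [hl1 hl2]].
      exists (w, l); auto.
    - exists (x, x); intro; contradiction. }
  pose (p := fun k => proj1_sig (constructive_indefinite_description _ (hw k))).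
  assert (hp : forall k, (exists w, W w /\ forall l, L k l -> eps <= dist X l w) ->
            Lim (snd (p k)) /\ dist X (snd (p k)) (fst (p k)) < eps / 2 /\
            forall l, L k l -> eps <= dist X l (fst (p k))).
  { intro k; unfold p; destruct (constructive_indefinite_description _ (hw k)); auto. }
  destruct (ulim_exists U X (fun k => snd (p k)) hU hX) as [l hl].
  assert (hLl : Lim l).
  { apply NNPP; intro hn. destruct (hclosed l hn) as [s [hs0 hball]].
    destruct (hex _ (hI _ _ hfar (hl s hs0))) as [k [h1 h2]].
    exact (hball _ h2 (proj1 (hp k h1))). }
  (* The far point is within [eps / 2] of [snd (p k)], this one within [eps / 4] of [l], and [l]
     within [eps / 4] of [L k]: together less than [eps]. *)
  destruct (hex _ (hI _ _ hfar (hI _ _ (hl (eps / 4) ltac:(lra)) (hLl (eps / 4) ltac:(lra)))))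
    as [k [h1 [h2 [y [h3 h4]]]]].
  destruct (hp k h1) as [_ [h5 h6]]. specialize (h6 y h3).
  pose proof (dist_tri X y l (fst (p k))).
  pose proof (dist_tri X l (snd (p k)) (fst (p k))).
  rewrite (dist_sym X y l) in *. lra.
Qed.

(** * Subspaces and gluing *)

Lemma continuous_proj (X : MetricSpace) (A : X -> Prop) :
  continuous (fun a : Subspace X A => proj1_sig a).
Proof. intros a eps h. exists eps; split; [exact h|]. intros b hb; exact hb. Qed.

Lemma continuous_comp (X Y Z : MetricSpace) (f : X -> Y) (g : Y -> Z) :
  continuous f -> continuous g -> continuous (fun x => g (f x)).
Proof.
  intros hf hg x eps h. destruct (hg (f x) eps h) as [r [hr hr']].
  destruct (hf x r hr) as [s [hs hs']]. exists s; split; auto.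
Qed.

Lemma subspace_open_extends (X : MetricSpace) (A : X -> Prop) (U : Subspace X A -> Prop) :
  is_open U ->
  exists V : X -> Prop, is_open V /\ forall a : Subspace X A, V (proj1_sig a) <-> U a.
Proof.
  intro hU.
  exists (fun z => exists (a : Subspace X A) r, 0 < r /\
            (forall b : Subspace X A, dist X (proj1_sig a) (proj1_sig b) < r -> U b) /\
            dist X (proj1_sig a) z < r). split.
  - intros z [a [r [hr [hb hz]]]]. exists (r - dist X (proj1_sig a) z); split; [lra|].
    intros y hy; exists a, r; split; [auto|split; [auto|]].
    pose proof (dist_tri X (proj1_sig a) z y); lra.
  - intro a; split.
    + intros [b [r [hr [hb hz]]]]; auto.
    + intro ha. destruct (hU a ha) as [r [hr hb]].
      exists a, r; split; [auto|split; [exact hb|rewrite dist_refl; exact hr]].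
Qed.

Lemma compact_subspace (X : MetricSpace) (A L : X -> Prop) :
  compact_set L -> subset L A ->
  compact_set (fun a : Subspace X A => L (proj1_sig a)).
Proof.
  intros hL hsub F hF hcov.
  pose (tr := fun (V : X -> Prop) (a : Subspace X A) => V (proj1_sig a)).
  (* [F] is a predicate on sets, so the trace of an open extension must be equal to [U], not merely
     equivalent to it. *)
  assert (hext : forall U V, (forall a : Subspace X A, V (proj1_sig a) <-> U a) -> tr V = U).
  { intros U V h. apply functional_extensionality; intro a.
    apply propositional_extensionality, h. }
  destruct (hL (fun V => is_open V /\ F (tr V))) as [l [h1 h2]].
  - intros V [h _]; exact h.
  - intros x hx. destruct (hcov (exist _ x (hsub x hx)) hx) as [U [hU hUx]].
    destruct (subspace_open_extends X A U (hF U hU)) as [V [hV hVU]].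
    exists V; split; [split; [exact hV|rewrite (hext U V hVU); exact hU]|].
    exact (proj2 (hVU _) hUx).
  - exists (map tr l). split.
    + intros U hU. apply in_map_iff in hU. destruct hU as [V [<- hV]]. apply h1, hV.
    + intros a ha. destruct (h2 _ ha) as [V [hV hVa]].
      exists (tr V); split; [apply in_map; exact hV|exact hVa].
Qed.

Lemma compact_space_subspace (X : MetricSpace) (A : X -> Prop) :
  compact_space X -> is_closed A -> compact_space (Subspace X A).
Proof.
  intros hX hA. apply compact_set_ext with (fun a : Subspace X A => A (proj1_sig a)).
  - intro a; split; [auto|intros _; exact (proj2_sig a)].
  - apply compact_subspace; [apply closed_compact; auto|intros x h; exact h].
Qed.

Lemma connected_subspace (X : MetricSpace) (A D : X -> Prop) :
  connected_set D -> subset D A ->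
  connected_set (fun a : Subspace X A => D (proj1_sig a)).
Proof.
  intros hD hsub U V hU hV hUV hd.
  destruct (subspace_open_extends X A U hU) as [U' [oU eU]].
  destruct (subspace_open_extends X A V hV) as [V' [oV eV]].
  destruct (hD U' V' oU oV) as [h|h].
  - intros x hx. destruct (hUV (exist _ x (hsub x hx)) hx) as [h|h].
    + left; exact (proj2 (eU _) h).
    + right; exact (proj2 (eV _) h).
  - intros x hx a b. apply (hd (exist _ x (hsub x hx)) hx).
    + apply eU; exact a.
    + apply eV; exact b.
  - left; intros a ha; apply eU, h, ha.
  - right; intros a ha; apply eV, h, ha.
Qed.

Lemma connected_image (X Y : MetricSpace) (f : X -> Y) (D : X -> Prop) :
  continuous f -> connected_set D -> connected_set (fun y => exists x, D x /\ f x = y).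
Proof.
  intros hf hD U V hU hV hUV hd.
  destruct (hD (fun x => U (f x)) (fun x => V (f x))) as [h|h].
  - apply open_preimage; auto.
  - apply open_preimage; auto.
  - intros x hx; apply hUV; eauto.
  - intros x hx a b; apply (hd (f x)); eauto.
  - left; intros y [x [hx <-]]; auto.
  - right; intros y [x [hx <-]]; auto.
Qed.

(* Restrictions to a closed cover of [X] do not suffice, since small subcontinua
   of [X] may all lie in fibers of [g]; the pieces have to contain whole fibers. *)
Lemma krasinkiewicz_glue (X M : MetricSpace) (g : X -> M) :
  compact_space X -> continuous g ->
  (forall x, exists (A : X -> Prop) (V : M -> Prop),
     krasinkiewicz_map (fun a : Subspace X A => g (proj1_sig a)) /\
     is_open V /\ V (g x) /\ forall z, V (g z) -> A z) ->
  krasinkiewicz_map g.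
Proof.
  intros hX hg hloc K hK.
  destruct hK as [[x hx] hK'].
  destruct (classic (subset K (fiber g (g x)))) as [hc|hc]; [left; eauto|right].
  apply not_all_ex_not in hc. destruct hc as [x1 hx1].
  assert (h1 : K x1 /\ g x1 <> g x).
  { split; [tauto|]. intro e; apply hx1; intro; exact e. }
  destruct h1 as [hKx1 hne].
  destruct (hloc x) as [A [V [hA [hV [hVx hVA]]]]].
  destruct (hV (g x) hVx) as [r [hr hball]].
  assert (hpos : 0 < dist M (g x) (g x1)) by (apply dist_pos; auto).
  pose proof (Rmin_l (r / 2) (dist M (g x) (g x1))).
  pose proof (Rmin_r (r / 2) (dist M (g x) (g x1))).
  (* [K] is shrunk to a continuum [L] with image in [V]; then [L] and all fibers over its image lie
     in [A]. *)
  destruct (boundary_bumping X M g K x x1 (Rmin (r / 2) (dist M (g x) (g x1))))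
    as [L [[_ [k1 k1']] [k2 [k3 [k4 [z [k5 k6]]]]]]]; auto.
  { split; [eauto|exact hK']. }
  { split; [apply Rmin_pos; lra|assumption]. }
  assert (hLV : forall w, L w -> V (g w)).
  { intros w hw; apply hball. specialize (k4 w hw); lra. }
  assert (hLA : subset L A) by (intros w hw; apply hVA, hLV, hw).
  destruct (hA (fun a => L (proj1_sig a))) as [[y hy]|[y [C [hC hCL]]]].
  - split; [|split; [apply compact_subspace; auto|apply connected_subspace; auto]].
    exists (exist _ x (hLA x k2)); exact k2.
  - exfalso; apply k6.
    rewrite (hy (exist _ z (hLA z k5)) k5), <- (hy (exist _ x (hLA x k2)) k2); reflexivity.
  - exists y, (fun w => exists a, C a /\ proj1_sig a = w).
    destruct hC as [[a ha] [c1 [c2 c3]]].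
    split; [|intros w [b [hb <-]]; exact (k3 _ (hCL b hb))].
    split; [exists (proj1_sig a), a; auto|split; [|split]].
    + intros w [b [hb <-]]; exact (c1 b hb).
    + apply connected_image; [apply continuous_proj|exact c2].
    + intros D hD hCD hDf.
      (* A connected set in the same fiber cannot leave [A], so maximality in the subspace is
         maximality in [X]. *)
      assert (hDA : subset D A).
      { intros w hw; apply hVA. rewrite (hDf w hw), <- (c1 a ha). apply hLV, hCL, ha. }
      intros w hw. exists (exist _ w (hDA w hw)); split; [|reflexivity].
      apply (c3 (fun b => D (proj1_sig b))).
      * apply connected_subspace; auto.
      * intros b hb; apply hCD; eauto.
      * intros b hb; exact (hDf _ hb).
      * exact hw.
Qed.

(** * Extension of families of real functions *)

Lemma glb_exists (E : R -> Prop) (x0 b : R) :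
  E x0 -> (forall x, E x -> b <= x) ->
  exists m, (forall x, E x -> m <= x) /\ forall c, (forall x, E x -> c <= x) -> c <= m.
Proof.
  intros h0 hb. destruct (completeness (fun x => E (- x))) as [m [h1 h2]].
  - exists (- b). intros x hx; specialize (hb _ hx); lra.
  - exists (- x0); rewrite Ropp_involutive; exact h0.
  - exists (- m); split.
    + intros x hx. assert (h : - x <= m); [|lra].
      apply h1. rewrite Ropp_involutive; exact hx.
    + intros c hc. assert (m <= - c); [|lra].
      apply h2. intros x hx; specialize (hc _ hx); lra.
Qed.

(* McShane's extension formula, with the Lipschitz condition relaxed to the family of
   moduli [t => 1/(n+1) + C n * t]. *)
Lemma equicontinuous_extension (X : MetricSpace) (A : X -> Prop) (I : Type)
    (phi : I -> Subspace X A -> R) (delta : R) (C : nat -> R) :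
  0 <= delta -> (forall n, 0 <= C n) ->
  (forall i a, Rabs (phi i a) <= delta) ->
  (forall n i a b, Rabs (phi i a - phi i b) <=
     / (INR n + 1) + C n * dist X (proj1_sig a) (proj1_sig b)) ->
  exists F : I -> X -> R,
    (forall i z, Rabs (F i z) <= delta) /\
    (forall i a, F i (proj1_sig a) = phi i a) /\
    (forall n i z w, Rabs (F i z - F i w) <= / (INR n + 1) + C n * dist X z w).
Proof.
  intros hdelta hC hphi hmod.
  (* The candidate [delta] truncates the infimum from above and keeps the set nonempty when [A] is
     empty. *)
  pose (S := fun i z t => t = delta \/ exists (a : Subspace X A) n,
          t = phi i a + / (INR n + 1) + C n * dist X z (proj1_sig a)).
  assert (hlow : forall i z t, S i z t -> - delta <= t).
  { intros i z t [->|[a [n ->]]]; [lra|].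
    pose proof (inv_INR_pos n). pose proof (Rmult_le_pos _ _ (hC n) (dist_nonneg X z (proj1_sig a))).
    pose proof (Rabs_def2 _ _ (Rle_lt_trans _ _ (delta + / (INR n + 1)) (hphi i a) ltac:(lra))).
    lra. }
  assert (hex : forall p : I * X, exists m, (forall t, S (fst p) (snd p) t -> m <= t) /\
            forall c, (forall t, S (fst p) (snd p) t -> c <= t) -> c <= m).
  { intros [i z]. apply glb_exists with delta (- delta); [left; reflexivity|].
    apply hlow. }
  pose (F := fun i z => proj1_sig (constructive_indefinite_description _ (hex (i, z)))).
  assert (hF : forall i z, (forall t, S i z t -> F i z <= t) /\
            forall c, (forall t, S i z t -> c <= t) -> c <= F i z).
  { intros i z; unfold F; destruct (constructive_indefinite_description _ (hex (i, z))); auto. }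
  clearbody F. exists F. split; [|split].
  - intros i z. apply Rabs_le; split.
    + apply (proj2 (hF i z)), hlow.
    + apply (proj1 (hF i z)); left; reflexivity.
  - intros i a. apply Rle_antisym.
    + apply Rnot_lt_le; intro hlt.
      destruct (inv_INR_lt (F i (proj1_sig a) - phi i a) ltac:(lra)) as [N hN].
      pose proof (proj1 (hF i (proj1_sig a)) _ (or_intror (ex_intro _ a (ex_intro _ N eq_refl)))) as h.
      rewrite dist_refl in h; lra.
    + apply (proj2 (hF i (proj1_sig a))). intros t [->|[b [n ->]]].
      * pose proof (Rle_abs (phi i a)); specialize (hphi i a); lra.
      * pose proof (hmod n i a b). pose proof (Rle_abs (phi i a - phi i b)); lra.
  - assert (hone : forall n i z w, F i z - F i w <= / (INR n + 1) + C n * dist X z w).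
    { intros n i z w.
      assert (h : F i z - (/ (INR n + 1) + C n * dist X z w) <= F i w); [|lra].
      pose proof (inv_INR_pos n) as hn.
      pose proof (Rmult_le_pos _ _ (hC n) (dist_nonneg X z w)) as hd.
      apply (proj2 (hF i w)). intros t [->|[a [k ->]]].
      - pose proof (proj1 (hF i z) _ (or_introl eq_refl)); lra.
      - pose proof (dist_tri X z w (proj1_sig a)) as ht.
        pose proof (inv_INR_pos k) as hk.
        pose proof (dist_nonneg X w (proj1_sig a)) as hwa.
        pose proof (dist_nonneg X z w) as hzw.
        (* A candidate at [w] with index [k] is compared with one at [z] that has the smaller of the
           two slopes; when that index is [n], its term 1/(n+1) is paid by the modulus. *)
        destruct (Rle_lt_dec (C k) (C n)) as [hle|hlt].
        + pose proof (proj1 (hF i z) _ (or_intror (ex_intro _ a (ex_intro _ k eq_refl)))) as h.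
          pose proof (Rmult_le_compat_l _ _ _ (hC k) ht).
          pose proof (Rmult_le_compat_r _ _ _ hzw hle). lra.
        + pose proof (proj1 (hF i z) _ (or_intror (ex_intro _ a (ex_intro _ n eq_refl)))) as h.
          pose proof (Rmult_le_compat_l _ _ _ (hC n) ht).
          pose proof (Rmult_le_compat_r _ _ _ hwa (Rlt_le _ _ hlt)). lra. }
    intros n i z w. apply Rabs_le. pose proof (hone n i z w). pose proof (hone n i w z).
    rewrite (dist_sym X w z) in *; lra.
Qed.

(** * The space of real functions and Kuratowski's embedding *)

(** The value 0 makes the supremum exist even for empty [I]. *)
Definition sup_set {I : Type} (u v : I -> R) (r : R) : Prop :=
  r = 0 \/ exists i, r = Rmin 1 (Rabs (u i - v i)).

Lemma sup_dist_sig {I : Type} (u v : I -> R) : {r | is_lub (sup_set u v) r}.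
Proof.
  apply completeness.
  - exists 1. intros r [->|[i ->]]; [lra|apply Rmin_l].
  - exists 0; left; reflexivity.
Qed.

(* Truncating at 1 makes this a metric on all functions, bounded or not. *)
Definition sup_dist {I : Type} (u v : I -> R) : R := proj1_sig (sup_dist_sig u v).

Lemma sup_dist_le {I : Type} (u v : I -> R) (c : R) :
  0 <= c -> (forall i, Rmin 1 (Rabs (u i - v i)) <= c) -> sup_dist u v <= c.
Proof.
  intros hc h. unfold sup_dist; destruct (sup_dist_sig u v) as [r hr]; simpl; destruct hr as [_ h2].
  apply h2. intros x [e|[i e]]; rewrite e; auto.
Qed.

Lemma sup_dist_ge {I : Type} (u v : I -> R) (i : I) :
  Rmin 1 (Rabs (u i - v i)) <= sup_dist u v.
Proof.
  unfold sup_dist; destruct (sup_dist_sig u v) as [r hr]; simpl; destruct hr as [h1 _].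
  apply h1; right; eauto.
Qed.

Lemma sup_dist_nonneg {I : Type} (u v : I -> R) : 0 <= sup_dist u v.
Proof.
  unfold sup_dist; destruct (sup_dist_sig u v) as [r hr]; simpl; destruct hr as [h1 _].
  apply h1; left; reflexivity.
Qed.

Lemma sup_dist_is_metric (I : Type) : is_metric (@sup_dist I).
Proof.
  split; [|split; [|split]].
  - apply sup_dist_nonneg.
  - intros u v; split.
    + intro h. apply functional_extensionality; intro i.
      pose proof (sup_dist_ge u v i) as h1. rewrite h in h1.
      pose proof (Rabs_pos (u i - v i)).
      destruct (Req_dec (u i) (v i)) as [e|ne]; [exact e|exfalso].
      assert (0 < Rabs (u i - v i)) by (apply Rabs_pos_lt; lra).
      assert (0 < Rmin 1 (Rabs (u i - v i))) by (apply Rmin_pos; lra). lra.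
    + intros ->. apply Rle_antisym; [|apply sup_dist_nonneg].
      apply sup_dist_le; [lra|]. intro i.
      replace (v i - v i) with 0 by lra. rewrite Rabs_R0. apply Rmin_r.
  - intros u v. apply Rle_antisym; (apply sup_dist_le; [apply sup_dist_nonneg|]);
      intro i; rewrite Rabs_minus_sym; apply sup_dist_ge.
  - intros u v w. pose proof (sup_dist_nonneg u v). pose proof (sup_dist_nonneg v w).
    apply sup_dist_le; [lra|]. intro i.
    apply Rle_trans with (Rmin 1 (Rabs (u i - v i)) + Rmin 1 (Rabs (v i - w i))).
    2:{ apply Rplus_le_compat; apply sup_dist_ge. }
    replace (u i - w i) with ((u i - v i) + (v i - w i)) by lra.
    pose proof (Rabs_triang (u i - v i) (v i - w i)).
    pose proof (Rabs_pos (u i - v i)). pose proof (Rabs_pos (v i - w i)).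
    unfold Rmin; repeat destruct Rle_dec; lra.
Qed.

Definition FunctionSpace (I : Type) : MetricSpace :=
  MkMetricSpace (I -> R) sup_dist (sup_dist_is_metric I).

Lemma sup_dist_lt1 {I : Type} (u v : I -> R) (i : I) :
  sup_dist u v < 1 -> Rabs (u i - v i) <= sup_dist u v.
Proof.
  intro h. pose proof (sup_dist_ge u v i) as h1.
  unfold Rmin in h1; destruct Rle_dec; lra.
Qed.

(** The usual subtraction of a base function is absent because the truncated metric admits unbounded
    functions. *)
Definition kuratowski (M : MetricSpace) (p : M) : FunctionSpace M := fun m => dist M p m.

Lemma kuratowski_dist_le (M : MetricSpace) (p q : M) :
  dist (FunctionSpace M) (kuratowski M p) (kuratowski M q) <= dist M p q.
Proof.
  apply sup_dist_le; [apply dist_nonneg|]. intro m.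
  apply Rle_trans with (1 := Rmin_r _ _). apply dist_lipschitz.
Qed.

Lemma kuratowski_dist_ge (M : MetricSpace) (p q : M) :
  dist (FunctionSpace M) (kuratowski M p) (kuratowski M q) < 1 ->
  dist M p q <= dist (FunctionSpace M) (kuratowski M p) (kuratowski M q).
Proof.
  intro h. pose proof (sup_dist_lt1 (kuratowski M p) (kuratowski M q) q h) as h1.
  unfold kuratowski at 1 2 in h1. rewrite dist_refl, Rminus_0_r in h1.
  rewrite Rabs_pos_eq in h1; [exact h1|apply dist_nonneg].
Qed.

(** Closedness is where completeness enters: image points approaching [u] come from a Cauchy
    sequence in [M], distances below 1 being preserved, and its limit is mapped to [u]. *)
Lemma kuratowski_closed_embedding (M : MetricSpace) :
  complete_wrt (dist M) -> closed_embedding (kuratowski M).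
Proof.
  intro hM. split; [|split; [|split]].
  - intros p eps h. exists eps; split; [exact h|]. intros q hq.
    apply Rle_lt_trans with (1 := kuratowski_dist_le M p q) (2 := hq).
  - intros p q e. apply dist_eq0. apply Rle_antisym; [|apply dist_nonneg].
    assert (h := kuratowski_dist_ge M p q). rewrite e, dist_refl in h.
    apply h; lra.
  - intros p eps h. exists (Rmin 1 eps); split; [apply Rmin_pos; lra|].
    intros q hq. pose proof (Rmin_l 1 eps). pose proof (Rmin_r 1 eps).
    pose proof (kuratowski_dist_ge M p q ltac:(lra)). lra.
  - intros u hu. apply NNPP; intro hn. apply hu.
    set (Y := FunctionSpace M) in *.
    assert (hk : forall k : nat, exists p, dist Y u (kuratowski M p) < / (INR k + 1)).
    { intro k. apply NNPP; intro hk. apply hn. exists (/ (INR k + 1)).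
      split; [apply inv_INR_pos|]. intros y hy [p <-]; eauto. }
    pose (p := fun k => proj1_sig (constructive_indefinite_description _ (hk k))).
    assert (hp : forall k, dist Y u (kuratowski M (p k)) < / (INR k + 1)).
    { intro k; unfold p; destruct (constructive_indefinite_description _ (hk k)); auto. }
    destruct (hM p) as [q hq].
    + intros eps he.
      assert (h2 : 0 < Rmin 1 eps) by (apply Rmin_pos; lra).
      pose proof (Rmin_l 1 eps). pose proof (Rmin_r 1 eps).
      destruct (inv_INR_lt (Rmin 1 eps / 2) ltac:(lra)) as [N hN].
      exists N. intros m n hm hn'.
      pose proof (inv_INR_antitone N m hm). pose proof (inv_INR_antitone N n hn').
      pose proof (hp m). pose proof (hp n).
      pose proof (dist_tri Y (kuratowski M (p m)) u (kuratowski M (p n))).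
      rewrite (dist_sym Y (kuratowski M (p m)) u) in *.
      assert (h : dist Y (kuratowski M (p m)) (kuratowski M (p n)) < Rmin 1 eps) by lra.
      assert (hge := kuratowski_dist_ge M (p m) (p n)). fold Y in hge. lra.
    + exists q. symmetry. apply (dist_eq0 Y). apply Rle_antisym; [|apply dist_nonneg].
      apply Rnot_lt_le; intro hpos. set (eps := dist Y u (kuratowski M q)) in *.
      destruct (inv_INR_lt (eps / 2) ltac:(lra)) as [N hN].
      destruct (hq (eps / 2) ltac:(lra)) as [N' hN'].
      specialize (hN' (max N N') ltac:(lia)).
      pose proof (inv_INR_antitone N (max N N') ltac:(lia)).
      pose proof (hp (max N N')).
      assert (hle := kuratowski_dist_le M (p (max N N')) q). fold Y in hle.
      assert (htri := dist_tri Y u (kuratowski M (p (max N N'))) (kuratowski M q)).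
      fold eps in htri. lra.
Qed.

(** * Extension of maps into a complete ANR *)

(** Not [h] but its difference from [g] in the function space is extended: it is small and stays
    small, and added to the embedded [g] it gives a map on which the retraction is defined and has
    values close to [g]. *)
Lemma anr_extension (X M : MetricSpace) (g : X -> M) (A : X -> Prop) (eps : R) :
  complete_wrt (dist M) -> ANR M -> compact_space X -> continuous g -> is_closed A -> 0 < eps ->
  exists delta, 0 < delta /\ forall h : Subspace X A -> M, continuous h ->
    (forall a, dist M (g (proj1_sig a)) (h a) < delta) ->
    exists g' : X -> M, continuous g' /\ (forall a, g' (proj1_sig a) = h a) /\
      forall z, dist M (g z) (g' z) < eps.
Proof.
  intros hM hR hX hg hA heps.
  set (Y := FunctionSpace M).
  destruct (hR Y (kuratowski M) (kuratowski_closed_embedding M hM))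
    as [V [hV [hVe [r [hr hre]]]]].
  (* [d] is a radius such that, uniformly in [z], the [d]-ball around the embedded [g z] lies in [V]
     and is retracted into the [eps]-ball around [g z]. *)
  destruct (compact_uniform X
    (fun z d => forall y : Y, dist Y (kuratowski M (g z)) y < d ->
       exists hy : V y, dist M (g z) (r (exist _ y hy)) < eps)) as [d [hd hunif]].
  - exact hX.
  - intros z d s hs h y hy; apply h; lra.
  - intro z.
    destruct (hV _ (hVe (g z))) as [d1 [hd1 hV1]].
    destruct (hr (exist _ (kuratowski M (g z)) (hVe (g z))) (eps / 2)) as [d2 [hd2 hr2]]; [lra|].
    rewrite hre in hr2.
    set (d := Rmin d1 d2). assert (hd : 0 < d) by (apply Rmin_pos; auto).
    assert (d <= d1) by apply Rmin_l. assert (d <= d2) by apply Rmin_r.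
    destruct (hg z (Rmin (d / 2) (eps / 2))) as [s [hs hgs]]; [apply Rmin_pos; lra|].
    exists s, (d / 2). split; [auto|split; [lra|]]. intros w hw y hy.
    specialize (hgs w hw).
    pose proof (Rmin_l (d / 2) (eps / 2)). pose proof (Rmin_r (d / 2) (eps / 2)).
    pose proof (kuratowski_dist_le M (g z) (g w)) as h1. fold Y in h1.
    pose proof (dist_tri Y (kuratowski M (g z)) (kuratowski M (g w)) y).
    assert (hzy : dist Y (kuratowski M (g z)) y < d) by lra.
    assert (hy' : V y) by (apply hV1; unfold Y in *; lra).
    exists hy'.
    assert (h2 := hr2 (exist _ y hy') ltac:(simpl; unfold sub_dist; simpl; unfold Y in *; simpl in *; lra)).
    pose proof (dist_tri M (g w) (g z) (r (exist _ y hy'))).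
    rewrite (dist_sym M (g w) (g z)) in *. lra.
  - exists (d / 2); split; [lra|]. intros h hh hclose.
    assert (hAc : compact_space (Subspace X A)) by (apply compact_space_subspace; auto).
    pose (phi := fun (m : M) (a : Subspace X A) => dist M (h a) m - dist M (g (proj1_sig a)) m).
    assert (hphi : forall m a, Rabs (phi m a) <= d / 2).
    { intros m a. apply Rle_trans with (1 := dist_lipschitz M _ _ m).
      rewrite dist_sym; specialize (hclose a); lra. }
    assert (hC : forall n : nat, exists C, 0 <= C /\ forall m a b,
              Rabs (phi m a - phi m b) <=
                / (INR n + 1) + C * dist X (proj1_sig a) (proj1_sig b)).
    { intro n. pose proof (inv_INR_pos n) as hn.
      destruct (uniform_continuity _ _ h hAc hh (/ (INR n + 1) / 2) ltac:(lra)) as [r1 [hr1 u1]].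
      destruct (uniform_continuity _ _ g hX hg (/ (INR n + 1) / 2) ltac:(lra)) as [r2 [hr2 u2]].
      set (s := Rmin r1 r2). assert (hs : 0 < s) by (apply Rmin_pos; auto).
      assert (s <= r1) by apply Rmin_l. assert (s <= r2) by apply Rmin_r.
      (* Below distance [s] uniform continuity suffices; from [s] on, [d / s] times the distance is
         at least [d], twice the bound on [phi]. *)
      exists (d / s). assert (hds : 0 < d / s) by (apply Rdiv_lt_0_compat; auto).
      split; [lra|]. intros m a b.
      pose proof (dist_nonneg X (proj1_sig a) (proj1_sig b)) as hab.
      destruct (Rlt_le_dec (dist X (proj1_sig a) (proj1_sig b)) s) as [hlt|hle].
      - pose proof (Rmult_le_pos _ _ (Rlt_le _ _ hds) hab).
        assert (h1 : dist M (h a) (h b) < / (INR n + 1) / 2) by (apply u1; simpl; unfold sub_dist; lra).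
        assert (h2 := u2 (proj1_sig a) (proj1_sig b) ltac:(lra)).
        pose proof (dist_lipschitz M (h a) (h b) m) as l1.
        pose proof (dist_lipschitz M (g (proj1_sig b)) (g (proj1_sig a)) m) as l2.
        rewrite (dist_sym M (g (proj1_sig b)) (g (proj1_sig a))) in l2.
        replace (phi m a - phi m b) with
          ((dist M (h a) m - dist M (h b) m) +
           (dist M (g (proj1_sig b)) m - dist M (g (proj1_sig a)) m)) by (unfold phi; lra).
        apply Rle_trans with (1 := Rabs_triang _ _). lra.
      - assert (h1 : d <= d / s * dist X (proj1_sig a) (proj1_sig b)).
        { apply Rle_trans with (d / s * s); [right; field; lra|].
          apply Rmult_le_compat_l; lra. }
        unfold Rminus at 1. apply Rle_trans with (1 := Rabs_triang _ _).
        rewrite Rabs_Ropp. pose proof (hphi m a). pose proof (hphi m b). lra. }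
    pose (C := fun n => proj1_sig (constructive_indefinite_description _ (hC n))).
    assert (hC' : forall n, 0 <= C n /\ forall m a b,
              Rabs (phi m a - phi m b) <=
                / (INR n + 1) + C n * dist X (proj1_sig a) (proj1_sig b)).
    { intro n; unfold C; destruct (constructive_indefinite_description _ (hC n)); auto. }
    clearbody C.
    destruct (equicontinuous_extension X A M phi (d / 2) C) as [F [hF1 [hF2 hF3]]];
      [lra|apply hC'|exact hphi|intro n; apply hC'|].
    pose (Phi := fun (z : X) => (fun m => dist M (g z) m + F m z) : Y).
    assert (hPhi : forall z, dist Y (kuratowski M (g z)) (Phi z) < d).
    { intro z. apply Rle_lt_trans with (d / 2); [|lra].
      apply sup_dist_le; [lra|]. intro m. apply Rle_trans with (1 := Rmin_r _ _).
      unfold kuratowski, Phi.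
      replace (dist M (g z) m - (dist M (g z) m + F m z)) with (- F m z) by lra.
      rewrite Rabs_Ropp; apply hF1. }
    assert (hVPhi : forall z, V (Phi z)).
    { intro z. destruct (hunif z (Phi z) (hPhi z)) as [hy _]; exact hy. }
    assert (cPhi : forall z e, 0 < e -> exists s, 0 < s /\
              forall w, dist X z w < s -> dist Y (Phi z) (Phi w) < e).
    { intros z e he. destruct (hg z (e / 4) ltac:(lra)) as [s1 [hs1 hgs]].
      destruct (inv_INR_lt (e / 4) ltac:(lra)) as [N hN].
      destruct (hC' N) as [hCN _].
      set (s2 := e / 4 / (C N + 1)). assert (hs2 : 0 < s2) by (apply Rdiv_lt_0_compat; lra).
      exists (Rmin s1 s2); split; [apply Rmin_pos; auto|]. intros w hw.
      pose proof (Rmin_l s1 s2). pose proof (Rmin_r s1 s2).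
      specialize (hgs w ltac:(lra)).
      assert (hCd : C N * dist X z w <= e / 4).
      { apply Rle_trans with ((C N + 1) * s2); [|right; unfold s2; field; lra].
        apply Rmult_le_compat; try lra. apply dist_nonneg. }
      apply Rle_lt_trans with (3 * (e / 4)); [|lra].
      apply sup_dist_le; [lra|]. intro m. apply Rle_trans with (1 := Rmin_r _ _).
      unfold Phi.
      replace (dist M (g z) m + F m z - (dist M (g w) m + F m w)) with
        ((dist M (g z) m - dist M (g w) m) + (F m z - F m w)) by lra.
      apply Rle_trans with (1 := Rabs_triang _ _).
      pose proof (dist_lipschitz M (g z) (g w) m). pose proof (hF3 N m z w). lra. }
    exists (fun z => r (exist _ (Phi z) (hVPhi z))). split; [|split].
    + intros z e he. destruct (hr (exist _ (Phi z) (hVPhi z)) e he) as [s [hs hrs]].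
      destruct (cPhi z s hs) as [s' [hs' hP]]. exists s'; split; [exact hs'|].
      intros w hw. apply hrs. exact (hP w hw).
    + intro a. rewrite <- (hre (h a) (hVe (h a))). f_equal. apply subset_eq_compat.
      apply functional_extensionality; intro m. unfold Phi, kuratowski.
      rewrite hF2; unfold phi; lra.
    + intro z. destruct (hunif z (Phi z) (hPhi z)) as [hy hz].
      rewrite (proof_irrelevance _ (hVPhi z) hy). exact hz.
Qed.

(** * Perturbations and the Baire argument *)

Lemma krasinkiewicz_map_injective_comp (X M N : MetricSpace) (g : X -> M) (i : M -> N) :
  (forall p q, i p = i q -> p = q) -> krasinkiewicz_map g ->
  krasinkiewicz_map (fun x => i (g x)).
Proof.
  intros hi hg K hK.
  assert (e : forall y, fiber (fun x => i (g x)) (i y) = fiber g y).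
  { intro y. apply functional_extensionality; intro x.
    apply propositional_extensionality; unfold fiber; split; [apply hi|congruence]. }
  destruct (hg K hK) as [[y hy]|[y [C hC]]].
  - left; exists (i y); rewrite e; exact hy.
  - right; exists (i y), C; rewrite e; exact hC.
Qed.

(** Compactness of [X] makes the continuity of [phi] uniform along the values of [psi (f x)], so
    approximation does not depend on the choice of metric. *)
Lemma krasinkiewicz_space_homeomorphic (M N : MetricSpace) (phi : M -> N) (psi : N -> M) :
  continuous phi -> continuous psi ->
  (forall x, psi (phi x) = x) -> (forall y, phi (psi y) = y) ->
  krasinkiewicz_space M -> krasinkiewicz_space N.
Proof.
  intros hphi hpsi h1 h2 hM X hX f eps hf heps.
  assert (hpf : continuous (fun x => psi (f x))) by (apply continuous_comp; auto).
  destruct (compact_uniform X (fun x d => forall p, dist M (psi (f x)) p < d ->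
              dist N (f x) (phi p) < eps)) as [d [hd hunif]].
  - exact hX.
  - intros x r s hs h p hp; apply h; lra.
  - intro x. destruct (hphi (psi (f x)) (eps / 2) ltac:(lra)) as [d [hd hd']].
    rewrite h2 in hd'.
    destruct (hpf x (d / 2) ltac:(lra)) as [r1 [hr1 u1]].
    destruct (hf x (eps / 2) ltac:(lra)) as [r2 [hr2 u2]].
    exists (Rmin r1 r2), (d / 2). split; [apply Rmin_pos; auto|split; [lra|]].
    intros y hy p hp. pose proof (Rmin_l r1 r2). pose proof (Rmin_r r1 r2).
    specialize (u1 y ltac:(lra)). specialize (u2 y ltac:(lra)).
    pose proof (dist_tri M (psi (f x)) (psi (f y)) p).
    specialize (hd' p ltac:(lra)).
    pose proof (dist_tri N (f y) (f x) (phi p)).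
    rewrite (dist_sym N (f y) (f x)) in *. lra.
  - destruct (hM X hX _ d hpf hd) as [g [hg [hk hclose]]].
    exists (fun x => phi (g x)). split; [apply continuous_comp; auto|split].
    + apply krasinkiewicz_map_injective_comp; [|exact hk].
      intros p q e. rewrite <- (h1 p), <- (h1 q), e; reflexivity.
    + intro x; apply hunif, hclose.
Qed.

(** Nested balls around f = g_0, g_1, ... stay inside the [eps]-ball around [f], and each new ball
    secures one more [P n]. Density is asked only at maps with room [eta] left in that ball, since
    only near [f] are the values on each closed piece under control. *)
Lemma uniform_baire (X M : MetricSpace) (f : X -> M) (eps : R) (P : nat -> (X -> M) -> Prop) :
  complete_wrt (dist M) -> continuous f -> 0 < eps ->
  (forall n (g : X -> M) eta, continuous g -> 0 < eta ->
     (forall z, dist M (f z) (g z) + eta <= eps) ->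
     exists g' : X -> M, continuous g' /\ (forall z, dist M (g z) (g' z) < eta) /\
       exists tau, 0 < tau /\ forall h : X -> M, (forall z, dist M (g' z) (h z) < tau) -> P n h) ->
  exists g : X -> M, continuous g /\ (forall z, dist M (f z) (g z) < eps) /\ forall n, P n g.
Proof.
  intros hM hf heps hdense.
  pose (good := fun s : (X -> M) * R => continuous (fst s) /\ 0 < snd s /\
          forall z, dist M (f z) (fst s z) <= eps - snd s).
  pose (next := fun (n : nat) (s s' : (X -> M) * R) =>
          (forall z, dist M (fst s z) (fst s' z) <= snd s / 2) /\ snd s' <= snd s / 2 /\
          forall h : X -> M, (forall z, dist M (fst s' z) (h z) <= snd s') -> P n h).
  assert (step : forall n (s : sig good), {s' : sig good | next n (proj1_sig s) (proj1_sig s')}).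
  { intros n [[g t] [h1 [h2 h3]]]; simpl in *. apply constructive_indefinite_description.
    destruct (hdense n g (t / 2) h1 ltac:(lra)) as [g' [k1 [k2 [tau [k3 k4]]]]].
    { intro z; specialize (h3 z); lra. }
    pose proof (Rmin_l (tau / 2) (t / 2)). pose proof (Rmin_r (tau / 2) (t / 2)).
    assert (hgood : good (g', Rmin (tau / 2) (t / 2))).
    { split; [exact k1|split; [apply Rmin_pos; lra|]]. intro z; simpl.
      specialize (h3 z). specialize (k2 z). pose proof (dist_tri M (f z) (g z) (g' z)); lra. }
    exists (exist _ _ hgood). split; [|split]; simpl.
    - intro z; left; apply k2.
    - assumption.
    - intros h hh; apply k4. intro z; specialize (hh z); lra. }
  (* The initial radius [eps / 2] keeps the limit strictly within [eps] of [f]. *)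
  assert (h0 : good (f, eps / 2)).
  { split; [exact hf|split; simpl; [lra|]]. intro z; rewrite dist_refl; lra. }
  pose (s := fix s (n : nat) : sig good :=
    match n with O => exist _ _ h0 | S n => proj1_sig (step n (s n)) end).
  pose (g := fun n => fst (proj1_sig (s n))). pose (t := fun n => snd (proj1_sig (s n))).
  assert (hnext : forall n, (forall z, dist M (g n z) (g (S n) z) <= t n / 2) /\
            t (S n) <= t n / 2 /\
            forall h : X -> M, (forall z, dist M (g (S n) z) (h z) <= t (S n)) -> P n h).
  { intro n; unfold g, t; simpl; destruct (step n (s n)) as [s' h]; exact h. }
  assert (hpos : forall n, 0 < t n) by (intro n; apply (proj2_sig (s n))).
  assert (hcont : forall n, continuous (g n)) by (intro n; apply (proj2_sig (s n))).
  assert (g0 : g 0%nat = f) by reflexivity. assert (t0 : t 0%nat = eps / 2) by reflexivity.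
  clearbody g t. clear s step h0 good next hdense.
  (* A bound cruder than the halving, but enough for [t n] to tend to 0. *)
  assert (htn : forall n, t n * (INR n + 1) <= eps).
  { induction n as [|n IH]; [rewrite t0; simpl; lra|].
    rewrite S_INR. destruct (hnext n) as [_ [h _]]. pose proof (pos_INR n).
    apply Rle_trans with (t n / 2 * (INR n + 1 + 1)); [apply Rmult_le_compat_r; lra|].
    pose proof (Rmult_le_pos _ _ (Rlt_le _ _ (hpos n)) H). lra. }
  assert (htend : forall e, 0 < e -> exists n, t n < e).
  { intros e he. destruct (inv_INR_lt (e / eps)) as [N hN]; [apply Rdiv_lt_0_compat; auto|].
    exists N. pose proof (pos_INR N). specialize (htn N).
    apply (Rmult_lt_compat_r (INR N + 1)) in hN; [|lra].
    rewrite Rinv_l in hN by lra.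
    apply (Rmult_lt_compat_r eps) in hN; [|lra].
    replace (e / eps * (INR N + 1) * eps) with (e * (INR N + 1)) in hN by (field; lra).
    apply Rmult_lt_reg_r with (INR N + 1); lra. }
  (* Each step is at most [t n / 2], hence at most [t n - t (S n)], so the distances telescope. *)
  assert (hclose : forall n m z, (n <= m)%nat -> dist M (g n z) (g m z) <= t n - t m).
  { intros n m z h. induction h as [|m h IH]; [rewrite dist_refl; lra|].
    destruct (hnext m) as [h1 [h2 _]]. specialize (h1 z).
    pose proof (dist_tri M (g n z) (g m z) (g (S m) z)). lra. }
  assert (hlim : forall z, exists l, forall n, dist M (g n z) l <= t n).
  { intro z. destruct (hM (fun n => g n z)) as [l hl].
    - intros e he. destruct (htend (e / 2) ltac:(lra)) as [N hN]. exists N. intros m n hm hn.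
      pose proof (hclose N m z hm). pose proof (hclose N n z hn).
      pose proof (hpos m). pose proof (hpos n).
      pose proof (dist_tri M (g m z) (g N z) (g n z)).
      rewrite (dist_sym M (g m z) (g N z)) in *. lra.
    - exists l. intro n. apply Rnot_lt_le; intro hlt.
      destruct (hl (dist M (g n z) l - t n) ltac:(lra)) as [N hN].
      specialize (hN (max n N) ltac:(lia)).
      pose proof (hclose n (max n N) z ltac:(lia)). pose proof (hpos (max n N)).
      pose proof (dist_tri M (g n z) (g (max n N) z) l). lra. }
  pose (G := fun z => proj1_sig (constructive_indefinite_description _ (hlim z))).
  assert (hG : forall z n, dist M (g n z) (G z) <= t n).
  { intro z; unfold G; destruct (constructive_indefinite_description _ (hlim z)); auto. }
  clearbody G. exists G. split; [|split].
  - intros z e he. destruct (htend (e / 3) ltac:(lra)) as [n hn].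
    destruct (hcont n z (e / 3) ltac:(lra)) as [r [hr h]].
    exists r; split; [exact hr|]. intros w hw. specialize (h w hw).
    pose proof (hG z n). pose proof (hG w n).
    pose proof (dist_tri M (G z) (g n z) (G w)). pose proof (dist_tri M (g n z) (g n w) (G w)).
    rewrite (dist_sym M (G z) (g n z)) in *. lra.
  - intro z. specialize (hG z 0%nat). rewrite g0, t0 in hG. lra.
  - intro n. apply (hnext n). intro z; apply hG.
Qed.

(** The order of choices matters: extendability fixes the tolerance [d], and only then is [g] on [A]
    approximated within [d] by a Krasinkiewicz map into [U]. *)
Lemma krasinkiewicz_perturbation (X M : MetricSpace) (g : X -> M) (A : X -> Prop)
    (U : M -> Prop) (eta : R) :
  complete_wrt (dist M) -> ANR M -> compact_space X -> continuous g -> is_closed A ->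
  krasinkiewicz_space (Subspace M U) -> (forall z, A z -> U (g z)) -> 0 < eta ->
  exists g' : X -> M, continuous g' /\ (forall z, dist M (g z) (g' z) < eta) /\
    krasinkiewicz_map (fun a : Subspace X A => g' (proj1_sig a)).
Proof.
  intros hM hR hX hg hA hU hAU heta.
  destruct (anr_extension X M g A eta hM hR hX hg hA heta) as [d [hd hext]].
  pose (gA := fun a : Subspace X A =>
    exist _ (g (proj1_sig a)) (hAU _ (proj2_sig a)) : Subspace M U).
  assert (hgA : continuous gA).
  { intros a e he. destruct (hg (proj1_sig a) e he) as [r [hr h]].
    exists r; split; [exact hr|]. intros b hb; exact (h _ hb). }
  destruct (hU _ (compact_space_subspace X A hX hA) gA d hgA hd) as [h [hh [hk hclose]]].
  destruct (hext (fun a => proj1_sig (h a))) as [g' [h1 [h2 h3]]].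
  - apply continuous_comp; [exact hh|apply continuous_proj].
  - exact hclose.
  - exists g'; split; [exact h1|split; [exact h3|]].
    replace (fun a : Subspace X A => g' (proj1_sig a)) with (fun a => proj1_sig (h a)).
    + apply krasinkiewicz_map_injective_comp; [|exact hk].
      intros p q e. destruct p as [p hp], q as [q hq]. simpl in e. subst q.
      f_equal; apply proof_irrelevance.
    + apply functional_extensionality; intro a; symmetry; apply h2.
Qed.

(** Each set is treated by a perturbation smaller than the tolerance already won for the others, so
    their conditions persist. The hypothesis on [U] refers to [f] rather than to the current map,
    which keeps it valid along the induction. *)
Lemma krasinkiewicz_perturbation_list (X M : MetricSpace) (e : R)
    (l : list (X -> Prop)) (f : X -> M) (eps : R) :
  complete_wrt (dist M) -> ANR M -> compact_space X -> 0 < e ->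
  (forall A, In A l -> is_closed A /\ exists U, krasinkiewicz_space (Subspace M U) /\
     forall z y, A z -> dist M (f z) y < eps -> U y) ->
  forall (g : X -> M) eta, continuous g -> 0 < eta ->
    (forall z, dist M (f z) (g z) + eta <= eps) ->
    exists g' : X -> M, continuous g' /\ (forall z, dist M (g z) (g' z) < eta) /\
      exists tau, 0 < tau /\ forall h : X -> M, (forall z, dist M (g' z) (h z) < tau) ->
        forall A, In A l -> eps_krasinkiewicz e (fun a : Subspace X A => h (proj1_sig a)).
Proof.
  intros hM hR hX he. induction l as [|A l IH]; intros hl g eta hg heta hgf.
  - exists g. split; [exact hg|split; [intro z; rewrite dist_refl; exact heta|]].
    exists 1; split; [lra|intros h _ A []].
  - destruct (IH (fun B h => hl B (or_intror h)) g (eta / 2) hg ltac:(lra))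
      as [g1 [h1 [h2 [t1 [h3 h4]]]]].
    { intro z; specialize (hgf z); lra. }
    destruct (hl A (or_introl eq_refl)) as [hA [U [hU hAU]]].
    (* Half of [t1] is spent on the new perturbation and half is left for [h]. *)
    pose proof (Rmin_l (eta / 2) (t1 / 2)). pose proof (Rmin_r (eta / 2) (t1 / 2)).
    destruct (krasinkiewicz_perturbation X M g1 A U (Rmin (eta / 2) (t1 / 2)))
      as [g' [k1 [k2 k3]]]; auto.
    { intros z hz. apply hAU with z; [exact hz|]. specialize (hgf z). specialize (h2 z).
      pose proof (dist_tri M (f z) (g z) (g1 z)). lra. }
    { apply Rmin_pos; lra. }
    destruct (krasinkiewicz_stable (Subspace X A) M (fun a => g' (proj1_sig a)) e)
      as [t2 [k4 k5]]; auto.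
    { apply compact_space_subspace; auto. }
    { apply (continuous_comp (Subspace X A) X M (fun a => proj1_sig a) g');
        [apply continuous_proj|exact k1]. }
    exists g'. split; [exact k1|split].
    { intro z. specialize (h2 z). specialize (k2 z).
      pose proof (dist_tri M (g z) (g1 z) (g' z)). lra. }
    exists (Rmin (t1 / 2) t2). split; [apply Rmin_pos; lra|].
    pose proof (Rmin_l (t1 / 2) t2). pose proof (Rmin_r (t1 / 2) t2).
    intros h hh B [<-|hB].
    + apply k5. intro a. specialize (hh (proj1_sig a)); lra.
    + apply h4; [|exact hB]. intro z. specialize (k2 z). specialize (hh z).
      pose proof (dist_tri M (g1 z) (g' z) (h z)). lra.
Qed.

(** * From local to global *)

Lemma krasinkiewicz_local_to_global (M : MetricSpace) (Cov : (M -> Prop) -> Prop) :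
  complete_wrt (dist M) -> ANR M ->
  (forall U, Cov U -> is_open U /\ krasinkiewicz_space (Subspace M U)) ->
  (forall x : M, exists U, Cov U /\ U x) ->
  krasinkiewicz_space M.
Proof.
  intros hM hR hCov hcov X hX f eps hf heps.
  (* For a center with radius r, the preimages under [f] of the r-balls will cover [X], those of the
     closed 2r-balls are the sets [A q], and the 3r-ball lies in a member of the cover. *)
  pose (good := fun q : M * R => 0 < snd q /\ exists U, Cov U /\
          forall y, dist M (fst q) y < 3 * snd q -> U y).
  assert (hl : exists l : list (M * R), (forall q, In q l -> good q) /\
            forall z, exists q, In q l /\ dist M (fst q) (f z) < snd q).
  { destruct (hX (fun W => exists q, good q /\ W = fun z => dist M (fst q) (f z) < snd q))
      as [l [h1 h2]].
    - intros W [q [_ ->]]. apply (open_preimage X M f (fun y => dist M (fst q) y < snd q));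
        [exact hf|apply open_ball].
    - intros z _. destruct (hcov (f z)) as [U [hU hz]].
      destruct (proj1 (hCov U hU) (f z) hz) as [r [hr hball]].
      exists (fun w => dist M (f z) (f w) < r / 3). split; [|rewrite dist_refl; lra].
      exists (f z, r / 3). split; [|reflexivity].
      split; simpl; [lra|]. exists U; split; [exact hU|]. intros y hy; apply hball; lra.
    - assert (hs : exists l', (forall q, In q l' -> good q) /\ forall W, In W l ->
                exists q, In q l' /\ forall z, W z -> dist M (fst q) (f z) < snd q).
      { clear h2. induction l as [|W l IH].
        - exists nil; split; intros ? [].
        - destruct IH as [l' [k1 k2]]; [intros; apply h1; right; auto|].
          destruct (h1 W (or_introl eq_refl)) as [q [hq ->]].
          exists (q :: l'). split; [intros q' [<-|h]; auto|].
          intros V [<-|hV]; [exists q; split; [left; reflexivity|auto]|].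
          destruct (k2 V hV) as [q' [k3 k4]]. exists q'; split; [right; exact k3|exact k4]. }
      destruct hs as [l' [k1 k2]]. exists l'; split; [exact k1|].
      intro z. destruct (h2 z I) as [W [hW hz]]. destruct (k2 W hW) as [q [hq hq']]. eauto. }
  destruct hl as [l [hl1 hl2]].
  assert (hrho : exists rho, 0 < rho /\ forall q, In q l -> rho <= snd q).
  { clear hl2. induction l as [|q l IH].
    - exists 1; split; [lra|intros ? []].
    - destruct IH as [rho [h1 h2]]; [intros; apply hl1; right; auto|].
      destruct (hl1 q (or_introl eq_refl)) as [hq _].
      exists (Rmin rho (snd q)); split; [apply Rmin_pos; auto|].
      intros q' [<-|h]; [apply Rmin_r|].
      apply Rle_trans with rho; [apply Rmin_l|auto]. }
  destruct hrho as [rho [hrho hrho']].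
  (* [rho / 2] is at most r/2. So maps [eps0]-close to [f] send [A q] within 5r/2 of the center,
     inside [U]; and a point sent by such a map within 3r/2 is sent by [f] within 2r, so [A q]
     contains whole fibers. *)
  pose (eps0 := Rmin eps (rho / 2)).
  assert (heps0 : 0 < eps0) by (apply Rmin_pos; lra).
  assert (he1 : eps0 <= eps) by apply Rmin_l. assert (he2 : eps0 <= rho / 2) by apply Rmin_r.
  clearbody eps0.
  pose (A := fun (q : M * R) z => dist M (fst q) (f z) <= 2 * snd q).
  assert (hA : forall q, is_closed (A q)).
  { intro q; apply (closed_ball_preimage X M f (fst q) (2 * snd q) hf). }
  destruct (uniform_baire X M f eps0
    (fun n h => forall B, In B (map A l) ->
       eps_krasinkiewicz (/ (INR n + 1)) (fun a : Subspace X B => h (proj1_sig a))))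
    as [g [hg [hgf hgP]]]; auto.
  - intro n.
    apply (krasinkiewicz_perturbation_list X M _ (map A l) f eps0 hM hR hX (inv_INR_pos n)).
    intros B hB. apply in_map_iff in hB. destruct hB as [q [<- hq]].
    split; [apply hA|].
    destruct (hl1 q hq) as [hq0 [U [hU hball]]].
    exists U; split; [apply hCov, hU|]. intros z y hz hy. apply hball.
    specialize (hrho' q hq). pose proof (dist_tri M (fst q) (f z) y).
    unfold A in hz. lra.
  - exists g. split; [exact hg|split].
    2:{ intro z; specialize (hgf z); lra. }
    apply krasinkiewicz_glue; [exact hX|exact hg|]. intro x.
    destruct (hl2 x) as [q [hq hx]]. specialize (hrho' q hq).
    exists (A q), (fun y => dist M (fst q) y < 3 / 2 * snd q). split; [|split; [|split]].
    + apply krasinkiewicz_of_eps.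
      * apply compact_space_subspace; auto.
      * apply (continuous_comp (Subspace X (A q)) X M (fun a => proj1_sig a) g);
          [apply continuous_proj|exact hg].
      * intros e he. destruct (inv_INR_lt e he) as [N hN].
        exists (/ (INR N + 1)). split; [pose proof (inv_INR_pos N); lra|].
        apply hgP, in_map, hq.
    + apply open_ball.
    + specialize (hgf x). pose proof (dist_tri M (fst q) (f x) (g x)). lra.
    + intros z hz. unfold A. specialize (hgf z).
      pose proof (dist_tri M (fst q) (g z) (f z)). rewrite (dist_sym M (g z) (f z)) in *. lra.
Qed.

(** * Independence of the metric, and the equivalence *)

Lemma continuous_id_finer (T : Type) (d d' : T -> T -> R) (H : is_metric d) (H' : is_metric d') :
  (forall U, open_wrt d' U -> open_wrt d U) ->
  continuous (M := MkMetricSpace T d H) (N := MkMetricSpace T d' H') (fun x => x).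
Proof.
  intros h x eps heps.
  destruct (h _ (open_ball (MkMetricSpace T d' H') x eps) x) as [r [hr hball]].
  - rewrite dist_refl; exact heps.
  - exists r; split; [exact hr|exact hball].
Qed.

Lemma continuous_id_subspaces (T : Type) (d d' : T -> T -> R) (H : is_metric d)
    (H' : is_metric d') (U : T -> Prop) :
  continuous (M := MkMetricSpace T d H) (N := MkMetricSpace T d' H') (fun x => x) ->
  continuous (M := Subspace (MkMetricSpace T d H) U) (N := Subspace (MkMetricSpace T d' H') U)
    (fun x => x).
Proof.
  intros h x eps heps. destruct (h (proj1_sig x) eps heps) as [r [hr hr']].
  exists r; split; [exact hr|]. intros y hy; exact (hr' _ hy).
Qed.

Lemma anr_homeomorphic (M N : MetricSpace) (phi : M -> N) (psi : N -> M) :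
  continuous phi -> continuous psi ->
  (forall x, psi (phi x) = x) -> (forall y, phi (psi y) = y) -> ANR M -> ANR N.
Proof.
  intros hphi hpsi h1 h2 hM Y e [e1 [e2 [e3 e4]]].
  destruct (hM Y (fun x => e (phi x))) as [V [hV [hVe [r [hr hre]]]]].
  - split; [apply continuous_comp; auto|split; [|split]].
    + intros x x' h. rewrite <- (h1 x), <- (h1 x'), (e2 _ _ h); reflexivity.
    + intros x eps heps. destruct (hpsi (phi x) eps heps) as [s [hs hs']].
      destruct (e3 (phi x) s hs) as [t [ht ht']].
      exists t; split; [exact ht|]. intros x' hx'.
      specialize (hs' _ (ht' _ hx')). rewrite !h1 in hs'; exact hs'.
    + apply open_ext with (2 := e4). intro y; split; intros h [x <-]; apply h; eauto.
      exists (psi x); rewrite h2; reflexivity.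
  - exists V. split; [exact hV|].
    assert (hVe' : forall y, V (e y)) by (intro y; rewrite <- (h2 y); apply hVe).
    split; [exact hVe'|].
    exists (fun v => phi (r v)). split; [apply continuous_comp; auto|].
    intro y. rewrite <- (h2 y). intro h. rewrite hre; reflexivity.
Qed.

Theorem theorem3p6 (M : MetricSpace) (HM : complete_ANR M) :
  krasinkiewicz_space M <->
  exists Cov : (M -> Prop) -> Prop,
    (forall U, Cov U -> is_open U /\ krasinkiewicz_space (Subspace M U)) /\
    (forall x : M, exists U, Cov U /\ U x).
Proof.
  split.
  - intro hK. exists (fun U => U = fun _ => True).
    split; [|intro x; exists (fun _ => True); auto].
    intros U ->. split; [intros x _; exists 1; split; [lra|auto]|].
    apply (krasinkiewicz_space_homeomorphic M (Subspace M (fun _ => True))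
             (fun x => exist _ x I) (fun a => proj1_sig a)).
    + intros x eps h; exists eps; split; [exact h|]. intros y hy; exact hy.
    + apply continuous_proj.
    + reflexivity.
    + intros [y []]; reflexivity.
    + exact hK.
  - intros [Cov [hCov hcov]]. destruct HM as [hR [d' [hd' [heq hc]]]].
    (* With [M] split, both metrics live on the same type [T], and the identity is the homeomorphism
       for the whole space and for every member of the cover. *)
    destruct M as [T d hd]; simpl in *.
    assert (c1 := continuous_id_finer T d d' hd hd' (fun U => proj2 (heq U))).
    assert (c2 := continuous_id_finer T d' d hd' hd (fun U => proj1 (heq U))).
    apply (krasinkiewicz_space_homeomorphic (MkMetricSpace T d' hd') (MkMetricSpace T d hd)
             (fun x => x) (fun x => x)); auto.
    apply krasinkiewicz_local_to_global with Cov; auto.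
    + apply (anr_homeomorphic (MkMetricSpace T d hd) (MkMetricSpace T d' hd')
               (fun x => x) (fun x => x)); auto.
    + intros U hU. destruct (hCov U hU) as [h1 h2]. split; [apply heq, h1|].
      apply (krasinkiewicz_space_homeomorphic (Subspace (MkMetricSpace T d hd) U)
               (Subspace (MkMetricSpace T d' hd') U) (fun x => x) (fun x => x)); auto;
        apply continuous_id_subspaces; assumption.
Qed.
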